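(* For every $(f,\mathfrak{A})\in \mathrm{Diff}(V)\times \mathrm{Sp}(2n_v , \mathbb{R})$, the map $\mathbb{A}_{f,\mathfrak{A}}$ induces by restriction a bijection: \begin{equation*} \mathbb{A}_{f,\mathfrak{A}}\colon \mathrm{Conf}_U(\mathcal{G},\mathcal{J})\to \mathrm{Conf}_U(f_{\ast}\mathcal{G},\mathcal{J}^f_{\mathfrak{A}})\, , \end{equation*} such that it further restricts to a bijection of the corresponding spaces of solutions: \begin{equation*} \mathbb{A}_{f,\mathfrak{A}}\colon \mathrm{Sol}_U(\mathcal{G},\mathcal{J})\to \mathrm{Sol}_U(f_{\ast}\mathcal{G},\mathcal{J}^f_{\mathfrak{A}})\, , \end{equation*} where $f_{\ast}\mathcal{G}$ is the push-forward of $\mathcal{G}$ by $f\colon V\to V$ and $\mathcal{J}^{f}_{\mathfrak{A}} = \mathfrak{A}\,(\mathcal{J}\circ f^{-1})\,\mathfrak{A}^{-1}$.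
   Context: Let $U\subset\mathbb{R}^4$ be a contractible, non-empty, oriented, relatively compact open subset, and let $V\subset \mathbb{R}^{n_s}$ be an oriented open subset. Let $\mathcal{G}$ be a Riemannian metric on $V$. Equip $\mathbb{R}^{2n_v}$ with its standard symplectic form $\omega=\sum_a f_a^\ast\wedge e_a^\ast$ (in the canonical basis $(e_1,\dots,e_{n_v},f_1,\dots,f_{n_v})$), and let $\mathrm{Sp}(2n_v,\mathbb{R})$ be the group of linear automorphisms preserving $\omega$; $\mathrm{Diff}(V)$ denotes the orientation-preserving diffeomorphisms of $V$. A taming map is a smooth map $\mathcal{J}\colon V\to \mathrm{Aut}(\mathbb{R}^{2n_v})$ such that at each point $\mathcal{J}$ is a complex structure with $\omega(\mathcal{J}\xi_1,\mathcal{J}\xi_2)=\omega(\xi_1,\xi_2)$ and $\omega(\xi,\mathcal{J}\xi)>0$ for $\xi\neq 0$; equivalently $\mathcal{J}=\begin{pmatrix} -\mathcal{I}^{-1}\mathcal{R} & \mathcal{I}^{-1}\\ -\mathcal{I}-\mathcal{R}\mathcal{I}^{-1}\mathcal{R} & \mathcal{R}\mathcal{I}^{-1}\end{pmatrix}$ for smooth symmetric-matrix-valued $\mathcal{R},\mathcal{I}$ on $V$ with $\mathcal{I}$ positive definite. The configuration space $\mathrm{Conf}_U(\mathcal{G},\mathcal{J})$ is the set of triples $(g,\phi,\mathcal{V})$ with $g$ a Lorentzian metric on $U$, $\phi\in C^\infty(U,V)$ and $\mathcal{V}\in\Omega^2(U,\mathbb{R}^{2n_v})$ satisfying $\ast_g\mathcal{V}=-(\mathcal{J}\circ\phi)(\mathcal{V})$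 (equivalently $\mathcal{V}=(F, \mathcal{R}(\phi)F-\mathcal{I}(\phi)\ast F)^t$ with $F\in\Omega^2(U,\mathbb{R}^{n_v})$). The solution space $\mathrm{Sol}_U(\mathcal{G},\mathcal{J})\subset \mathrm{Conf}_U(\mathcal{G},\mathcal{J})$ consists of the triples satisfying the equations of motion of local bosonic supergravity: the Einstein equations $\mathrm{G}^g_{ab}= \mathcal{G}_{ij}(\phi) \partial_a \phi^i \partial_b \phi^j - \frac{1}{2} g_{ab} \mathcal{G}_{ij}(\phi) \partial_c \phi^i \partial^c \phi^j + 2 \mathcal{I}_{\Lambda \Sigma}(\phi) F^{\Lambda}_{ac} F^{\Sigma c}_b - \frac{1}{2} g_{ab} \mathcal{I}_{\Lambda \Sigma}(\phi) F^{\Lambda}_{cd} F^{\Sigma cd}$ (with $\mathrm{G}^g$ the Einstein tensor), the scalar equations $\nabla_a^g (\mathcal{G}_{ik}(\phi) \partial^a \phi^i) = \frac{1}{2} \partial_k \mathcal{G}_{ij}(\phi) \partial_a \phi^i \partial^a \phi^j + \frac{1}{2} \partial_k \mathcal{R}_{\Lambda \Sigma}(\phi) F^{\Lambda}_{ab} \ast F^{\Sigma ab} + \frac{1}{2} \partial_k \mathcal{I}_{\Lambda \Sigma}(\phi) F^{\Lambda}_{ab} F^{\Sigma ab}$, and the Maxwell equations, which are equivalent to $\mathrm{d}\mathcal{V}=0$. For $(f,\mathfrak{A})\in \mathrm{Diff}(V)\times \mathrm{Sp}(2n_v,\mathbb{R})$, the map $\mathbb{A}_{f,\mathfrak{A}}$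 sends $(g,\phi,\mathcal{V})\mapsto (g,f\circ\phi,\mathfrak{A}\mathcal{V})$ on $\mathrm{Lor}(U)\times C^\infty(U,V)\times\Omega^2(U,\mathbb{R}^{2n_v})$. *)

(* Defs.v *)
(* Coordinate (chart-free) formalisation on open
   subsets U of R^4 and V of R^ns; points are row vectors 'rV[R]_n. *)
From HB Require Import structures.
From mathcomp Require Import all_boot all_order all_algebra.
From mathcomp Require Import all_classical all_reals.
From mathcomp Require Import topology normedtype derive.
Set Implicit Arguments. Unset Strict Implicit. Unset Printing Implicit Defensive.
Import Order.TTheory GRing.Theory Num.Theory.
Import numFieldNormedType.Exports.
Local Open Scope classical_set_scope.
Local Open Scope ring_scope.

Section Defs.
Variable R : realType.

Definition ei (n : nat) (i : 'I_n) : 'rV[R]_n := delta_mx 0 i.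

Definition pd (n : nat) (W : normedModType R) (h : 'rV[R]_n -> W) (i : 'I_n)
  : 'rV[R]_n -> W := fun x => derive h x (ei i).

Fixpoint pds (n : nat) (l : seq 'I_n) (h : 'rV[R]_n -> R) : 'rV[R]_n -> R :=
  match l with
  | [::] => h
  | i :: l' => pd (pds l' h) i
  end.

Definition smooth_on (n : nat) (D : set 'rV[R]_n) (h : 'rV[R]_n -> R) :=
  forall (l : seq 'I_n) x, D x ->
    {for x, continuous (pds l h)} /\ forall i, derivable (pds l h) x (ei i).

Definition smooth_mx (n p q : nat) (D : set 'rV[R]_n) (h : 'rV[R]_n -> 'M[R]_(p, q)) :=
  forall i j, smooth_on D (fun x => h x i j).

Definition jac (n m : nat) (F : 'rV[R]_n -> 'rV[R]_m) (x : 'rV[R]_n) : 'M[R]_(m, n) :=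
  \matrix_(i, j) derive (fun z => F z 0 i) x (ei j).

Definition contractible (n : nat) (D : set 'rV[R]_n) :=
  exists (x0 : 'rV[R]_n) (H : R * 'rV[R]_n -> 'rV[R]_n),
    {within [set p | 0 <= p.1 <= 1 /\ D p.2], continuous H} /\
    (forall t x, 0 <= t <= 1 -> D x -> D (H (t, x))) /\
    (forall x, D x -> H (0, x) = x) /\ (forall x, D x -> H (1, x) = x0).

(* U : contractible, non-empty, relatively compact open subset of R^4
   (oriented by the standard orientation of R^4) *)
Definition spacetime_domain (U : set 'rV[R]_4) :=
  open U /\ (exists x, U x) /\ contractible U /\ compact (closure U).

Definition lorentzian (U : set 'rV[R]_4) (g : 'rV[R]_4 -> 'M[R]_4) :=
  smooth_mx U g /\
  forall x, U x -> (g x)^T = g x /\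
    exists P : 'M[R]_4, P \in unitmx /\
      P^T *m g x *m P = diag_mx (\row_(i < 4) (if i == 0 then -1 else 1)).

Definition riemannian (ns : nat) (V : set 'rV[R]_ns) (G : 'rV[R]_ns -> 'M[R]_ns) :=
  smooth_mx V G /\
  forall y, V y -> (G y)^T = G y /\
    forall v : 'rV[R]_ns, v != 0 -> 0 < (v *m G y *m v^T) 0 0.

Definition pushforward (ns : nat) (finv : 'rV[R]_ns -> 'rV[R]_ns)
  (G : 'rV[R]_ns -> 'M[R]_ns) : 'rV[R]_ns -> 'M[R]_ns :=
  fun y => (jac finv y)^T *m G (finv y) *m jac finv y.

Definition diffeo (ns : nat) (V : set 'rV[R]_ns) (f finv : 'rV[R]_ns -> 'rV[R]_ns) :=
  smooth_mx V f /\ smooth_mx V finv /\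
  (forall y, V y -> V (f y)) /\ (forall y, V y -> V (finv y)) /\
  (forall y, V y -> f (finv y) = y) /\ (forall y, V y -> finv (f y) = y) /\
  (forall y, V y -> 0 < \det (jac f y)).

(* coordinates: e_a <-> lshift nv a, f_a <-> rshift nv a;
   omega = sum_a f_a^* /\ e_a^* *)
Definition omega (nv : nat) (x y : 'cV[R]_(nv + nv)) : R :=
  \sum_(a < nv) (x (rshift nv a) 0 * y (lshift nv a) 0
                 - x (lshift nv a) 0 * y (rshift nv a) 0).

Definition symplectic (nv : nat) (A : 'M[R]_(nv + nv)) :=
  A \in unitmx /\ forall x y, omega (A *m x) (A *m y) = omega x y.

Definition taming (ns nv : nat) (V : set 'rV[R]_ns) (J : 'rV[R]_ns -> 'M[R]_(nv + nv)) :=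
  smooth_mx V J /\
  forall y, V y ->
    J y *m J y = - 1%:M /\
    (forall x1 x2, omega (J y *m x1) (J y *m x2) = omega x1 x2) /\
    (forall x, x != 0 -> 0 < omega x (J y *m x)).

(* the matrices I and R determined by J via the block form of J *)
Definition Imat (ns nv : nat) (J : 'rV[R]_ns -> 'M[R]_(nv + nv)) (y : 'rV[R]_ns)
  : 'M[R]_nv := invmx (ursubmx (J y)).
Definition Rmat (ns nv : nat) (J : 'rV[R]_ns -> 'M[R]_(nv + nv)) (y : 'rV[R]_ns)
  : 'M[R]_nv := - (Imat J y *m ulsubmx (J y)).

(* a 2-form with values in R^k : its components F a b x *)
Definition form2 (k : nat) := 'I_4 -> 'I_4 -> 'rV[R]_4 -> 'cV[R]_k.

Definition is_form2 (k : nat) (U : set 'rV[R]_4) (F : form2 k) :=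
  (forall a b, smooth_mx U (F a b)) /\ (forall a b x, F a b x = - F b a x).

(* Levi-Civita symbol, eps_{0123} = 1 *)
Definition levi (a b c d : 'I_4) : R :=
  \det (\matrix_(i < 4, j < 4) ((tnth [tuple a; b; c; d] i == j)%:R : R)).

Definition ginv (g : 'rV[R]_4 -> 'M[R]_4) (x : 'rV[R]_4) : 'M[R]_4 := invmx (g x).

Definition hodge (k : nat) (g : 'rV[R]_4 -> 'M[R]_4) (F : form2 k) : form2 k :=
  fun a b x => (2^-1 * Num.sqrt `|\det (g x)|) *:
    \sum_(c < 4) \sum_(d < 4) \sum_(e < 4) \sum_(f < 4)
       (levi a b c d * ginv g x c e * ginv g x d f) *: F e f x.

Definition christoffel (g : 'rV[R]_4 -> 'M[R]_4) (k i j : 'I_4) : 'rV[R]_4 -> R :=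
  fun x => 2^-1 * \sum_(l < 4) ginv g x k l *
     (pd (fun y => g y j l) i x + pd (fun y => g y i l) j x
      - pd (fun y => g y i j) l x).

(* R^r_{s m n} *)
Definition riemann (g : 'rV[R]_4 -> 'M[R]_4) (r s m n : 'I_4) (x : 'rV[R]_4) : R :=
  pd (christoffel g r n s) m x - pd (christoffel g r m s) n x
  + \sum_(l < 4) (christoffel g r m l x * christoffel g l n s x
                  - christoffel g r n l x * christoffel g l m s x).

Definition ricci (g : 'rV[R]_4 -> 'M[R]_4) (s n : 'I_4) (x : 'rV[R]_4) : R :=
  \sum_(r < 4) riemann g r s r n x.

Definition scalar_curv (g : 'rV[R]_4 -> 'M[R]_4) (x : 'rV[R]_4) : R :=
  \sum_(s < 4) \sum_(n < 4) ginv g x s n * ricci g s n x.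

Definition einstein (g : 'rV[R]_4 -> 'M[R]_4) (a b : 'I_4) (x : 'rV[R]_4) : R :=
  ricci g a b x - 2^-1 * g x a b * scalar_curv g x.

Record config (ns nv : nat) := Config {
  cg : 'rV[R]_4 -> 'M[R]_4;
  cphi : 'rV[R]_4 -> 'rV[R]_ns;
  cV : form2 (nv + nv) }.

Definition Conf (ns nv : nat) (U : set 'rV[R]_4) (V : set 'rV[R]_ns)
  (J : 'rV[R]_ns -> 'M[R]_(nv + nv)) (c : config ns nv) :=
  lorentzian U (cg c) /\ smooth_mx U (cphi c) /\ (forall x, U x -> V (cphi c x)) /\
  is_form2 U (cV c) /\
  forall x, U x -> forall a b,
    hodge (cg c) (cV c) a b x = - (J (cphi c x) *m cV c a b x).

Definition Fform (ns nv : nat) (c : config ns nv) : form2 nv :=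
  fun a b x => usubmx (cV c a b x).

Definition dphi (ns nv : nat) (c : config ns nv) (i : 'I_ns) (a : 'I_4) (x : 'rV[R]_4) : R :=
  pd (fun y => cphi c y 0 i) a x.

Definition einstein_eqs (ns nv : nat) (U : set 'rV[R]_4)
  (G : 'rV[R]_ns -> 'M[R]_ns) (J : 'rV[R]_ns -> 'M[R]_(nv + nv)) (c : config ns nv) :=
  let g := cg c in let F := Fform c in
  forall x, U x -> forall a b : 'I_4,
    einstein g a b x =
      \sum_(i < ns) \sum_(j < ns) G (cphi c x) i j * dphi c i a x * dphi c j b x
    - 2^-1 * g x a b * (\sum_(i < ns) \sum_(j < ns) G (cphi c x) i j *
          \sum_(p < 4) \sum_(q < 4) ginv g x p q * dphi c i p x * dphi c j q x)
    + 2 * (\sum_(L < nv) \sum_(S < nv) Imat J (cphi c x) L S *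
          \sum_(p < 4) \sum_(q < 4) F a p x L 0 * ginv g x p q * F b q x S 0)
    - 2^-1 * g x a b * (\sum_(L < nv) \sum_(S < nv) Imat J (cphi c x) L S *
          \sum_(p < 4) \sum_(q < 4) \sum_(r < 4) \sum_(s < 4)
             F p q x L 0 * ginv g x p r * ginv g x q s * F r s x S 0).

Definition scalar_eqs (ns nv : nat) (U : set 'rV[R]_4)
  (G : 'rV[R]_ns -> 'M[R]_ns) (J : 'rV[R]_ns -> 'M[R]_(nv + nv)) (c : config ns nv) :=
  let g := cg c in let F := Fform c in let sF := hodge g (Fform c) in
  let X (k : 'I_ns) (a : 'I_4) : 'rV[R]_4 -> R := fun y =>
      \sum_(i < ns) G (cphi c y) i k * \sum_(b < 4) ginv g y a b * dphi c i b y in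
  forall x, U x -> forall k : 'I_ns,
    \sum_(a < 4) (pd (X k a) a x + \sum_(b < 4) christoffel g a a b x * X k b x)
    = 2^-1 * (\sum_(i < ns) \sum_(j < ns) pd (fun y => G y i j) k (cphi c x) *
          \sum_(p < 4) \sum_(q < 4) ginv g x p q * dphi c i p x * dphi c j q x)
    + 2^-1 * (\sum_(L < nv) \sum_(S < nv) pd (fun y => Rmat J y L S) k (cphi c x) *
          \sum_(p < 4) \sum_(q < 4) \sum_(r < 4) \sum_(s < 4)
             F p q x L 0 * ginv g x p r * ginv g x q s * sF r s x S 0)
    + 2^-1 * (\sum_(L < nv) \sum_(S < nv) pd (fun y => Imat J y L S) k (cphi c x) *
          \sum_(p < 4) \sum_(q < 4) \sum_(r < 4) \sum_(s < 4)
             F p q x L 0 * ginv g x p r * ginv g x q s * F r s x S 0).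

Definition maxwell_eqs (ns nv : nat) (U : set 'rV[R]_4) (c : config ns nv) :=
  forall x, U x -> forall a b e : 'I_4,
    pd (cV c b e) a x + pd (cV c e a) b x + pd (cV c a b) e x = 0.

Definition Sol (ns nv : nat) (U : set 'rV[R]_4) (V : set 'rV[R]_ns)
  (G : 'rV[R]_ns -> 'M[R]_ns) (J : 'rV[R]_ns -> 'M[R]_(nv + nv)) (c : config ns nv) :=
  Conf U V J c /\ einstein_eqs U G J c /\ scalar_eqs U G J c /\ maxwell_eqs U c.

Definition Amap (ns nv : nat) (f : 'rV[R]_ns -> 'rV[R]_ns) (A : 'M[R]_(nv + nv))
  (c : config ns nv) : config ns nv :=
  Config (cg c) (fun x => f (cphi c x)) (fun a b x => A *m cV c a b x).

Definition Jtrans (ns nv : nat) (finv : 'rV[R]_ns -> 'rV[R]_ns) (A : 'M[R]_(nv + nv))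
  (J : 'rV[R]_ns -> 'M[R]_(nv + nv)) : 'rV[R]_ns -> 'M[R]_(nv + nv) :=
  fun y => A *m J (finv y) *m invmx A.

(* fields on U are identified when they agree on U *)
Definition eqU (ns nv : nat) (U : set 'rV[R]_4) (c c' : config ns nv) :=
  forall x, U x -> cg c x = cg c' x /\ cphi c x = cphi c' x /\
                   forall a b, cV c a b x = cV c' a b x.

Definition bij_onU (ns nv : nat) (U : set 'rV[R]_4) (P P' : config ns nv -> Prop)
  (m : config ns nv -> config ns nv) :=
  (forall c, P c -> P' (m c)) /\
  (forall c c', P c -> P c' -> eqU U c c' -> eqU U (m c) (m c')) /\
  (forall c c', P c -> P c' -> eqU U (m c) (m c') -> eqU U c c') /\
  (forall c', P' c' -> exists2 c, P c & eqU U (m c) c').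

End Defs.

(* Main.v *)
Require Import Defs.
From HB Require Import structures.
From mathcomp Require Import all_boot all_order all_algebra.
From mathcomp Require Import all_classical all_reals.
From mathcomp Require Import topology normedtype landau derive.
From mathcomp Require Import ring lra.
Set Implicit Arguments. Unset Strict Implicit. Unset Printing Implicit Defensive.
Import Order.TTheory GRing.Theory Num.Theory.
Import numFieldNormedType.Exports.
Local Open Scope classical_set_scope.
Local Open Scope ring_scope.

(** In terms of the twisted self-dual field [V = (F, H)], the two source terms
    of the field equations have manifestly symplectic-invariant expressions.
    Since [*V = - J V], the vector stress tensor is
      [2 I F_ap F_b^p - 1/2 g_ab I F.F = g^pq omega(V_ap, J V_bq)],
    thanks to the four-dimensional identity
      [*M g^-1 *N = N g^-1 M - 1/2 tr (N g^-1 M g^-1) g]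
    for two-forms, and differentiating the block form of [J] gives
      [(d_k R) F.*F + (d_k I) F.F = 1/2 omega(V, (d_k J) V)].
    Replacing [V] by [A V] and [J] by [A J A^-1] preserves both, while [f] acts
    as a change of coordinates on the target: the Einstein equation is
    unchanged and the scalar equations get multiplied by the invertible
    transposed Jacobian of [f^-1], the second derivatives of [f^-1] cancelling
    because they are symmetric. *)

(** * Calculus and smoothness *)

(** Under a symplectic [A] the field [F] mixes with the lower half [H] of [V], and [Imat] and [Rmat]
    transform by a fractional linear rule that mixes them too, so the equations written with [F],
    [Imat] and [Rmat] are not covariant by inspection. Self-duality repairs this: [omega(V, J V)]
    contains [F] and [*F] on an equal footing, and in Lorentzian signature [*F.*F = - F.F], so the
    [*F *F] part reproduces both the other half of the quadratic term and the trace term. A second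
    obstacle is that [smooth_on] speaks only of iterated derivatives along the axes. The chain rule
    and the equality of mixed partials needed for the coordinate change are therefore derived from
    the continuity of partial derivatives and the one-variable mean value theorem. *)

Section Calculus.
Variable R : realType.

Lemma is_derive_line (V : normedModType R) (h : V -> R) (x e : V) (s : R) :
  derivable h (x + s *: e) e ->
  is_derive s 1 (fun t : R => h (x + t *: e)) ('D_e h (x + s *: e)).
Proof.
have E : (fun t : R => t^-1 *: (((fun t => h (x + t *: e)) \o shift s) (t *: 1)
            - h (x + s *: e))) =
         (fun t : R => t^-1 *: ((h \o shift (x + s *: e)) (t *: e)
            - h (x + s *: e))).
  apply/funext => t /=; congr (_ *: (h _ - _)).
  by rewrite scalerDl [t *: 1]mulr1 addrCA.
by move=> dh; split; rewrite /derivable /derive E.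
Qed.

(** Bounding the intermediate point by [|s| <= |t|] treats both signs of [t] at once and is the form
    in which membership in a ball is checked later. *)
Lemma MVT_line (V : normedModType R) (h : V -> R) (x e : V) (t : R) :
  (forall s : R, `|s| <= `|t| -> derivable h (x + s *: e) e) ->
  exists2 s, `|s| <= `|t| & h (x + t *: e) - h x = t * 'D_e h (x + s *: e).
Proof.
move=> dh; pose k s := h (x + s *: e).
have k0 : k 0 = h x by rewrite /k scale0r addr0.
have dk (s : R) : `|s| <= `|t| -> is_derive s 1 k ('D_e h (x + s *: e)).
  by move=> /dh; exact: is_derive_line.
have kc (a b : R) : (forall s, s \in `[a, b]%R -> `|s| <= `|t|) ->
    {within `[a, b], continuous k}.
  by move=> ab; apply: derivable_within_continuous => s /ab /dk [].
have [t0|t0] := leP 0 t.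
  have b (s : R) : s \in `[0, t]%R -> `|s| <= `|t|.
    by rewrite in_itv /= => /andP[s0 st]; rewrite !ger0_norm.
  have [s|s /b st] := @MVT_segment R k (fun s => 'D_e h (x + s *: e)) _ _
    t0 _ (kc _ _ b); last first.
    by rewrite -/(k t) k0 subr0 mulrC; exists s.
  by move=> st; apply: dk; apply: b; exact: subset_itv_oo_cc st.
have b (s : R) : s \in `[t, 0]%R -> `|s| <= `|t|.
  by rewrite in_itv /= => /andP[s0 st]; rewrite !ler0_norm ?lerN2// ltW.
have [s|s /b st] := @MVT_segment R k (fun s => 'D_e h (x + s *: e)) _ _
  (ltW t0) _ (kc _ _ b); last first.
  rewrite -/(k t) k0 sub0r mulrN => /eqP.
  by rewrite -eqr_oppLR opprB mulrC => /eqP; exists s.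
by move=> st; apply: dk; apply: b; exact: subset_itv_oo_cc st.
Qed.

Lemma continuous_at_sum (T : topologicalType) (I : Type) (r : seq I)
    (F : I -> T -> R) (x : T) :
  (forall i, {for x, continuous (F i)}) ->
  {for x, continuous (fun y => \sum_(i <- r) F i y)}.
Proof.
move=> cF; elim: r => [|i r IH].
  rewrite (_ : (fun y => _) = cst 0); first exact: cst_continuous.
  by apply/funext => y; rewrite big_nil.
rewrite (_ : (fun y => _) = F i \+ (fun y => \sum_(j <- r) F j y)).
  exact: continuousD.
by apply/funext => y; rewrite big_cons.
Qed.

Lemma coord_le_norm n (v : 'rV[R]_n) i : `|v 0 i| <= `|v|.
Proof.
rewrite [leRHS]/Num.Def.normr/= mx_normrE.
exact: (le_bigmax _ (fun ij => `|v ij.1 ij.2|) (0, i)).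
Qed.

Lemma norm_le_coord n (v : 'rV[R]_n) (r : R) :
  0 <= r -> (forall i, `|v 0 i| <= r) -> `|v| <= r.
Proof.
move=> r0 vr; rewrite [leLHS]/Num.Def.normr/= mx_normrE (bigmax_le _ r0)//=.
by move=> [a b] _ /=; rewrite (ord1 a).
Qed.

Lemma norm_ei_le n (i : 'I_n) : `|ei R i| <= 1.
Proof.
apply: norm_le_coord => // j; rewrite mxE eqxx /=.
by case: (j == i); rewrite ?normr1 ?normr0.
Qed.

(* Telescope along the path from x to x + v that changes one coordinate at a
   time, and apply the mean value theorem to each step. *)
Lemma differentiable_partials n (h : 'rV[R]_n -> R) (x : 'rV[R]_n) :
  (\forall y \near x, forall i, derivable h y (ei R i)) ->
  (forall i, {for x, continuous (pd h i)}) ->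
  differentiable h x /\
  forall v, 'd h x v = \sum_i v 0 i * pd h i x.
Proof.
move=> dh ch; pose d (v : 'rV[R]_n) : R := \sum_i v 0 i * pd h i x.
have dlin : linear d.
  move=> a u v; rewrite /d scaler_sumr -big_split /=; apply: eq_bigr => i _.
  by rewrite !mxE mulrDl [_ *: _]mulrA.
pose dL : {linear 'rV[R]_n -> R} :=
  HB.pack d (GRing.isLinear.Build _ _ _ _ _ dlin).
have dc : continuous dL.
  move=> v; apply: (@continuous_at_sum _ _ _ (fun i (v : 'rV[R]_n) => v 0 i * pd h i x)).
  by move=> i; apply: continuousM; [exact: coord_continuous|exact: cst_continuous].
have ho : h \o shift x = cst (h x) + dL +o_ (0 : 'rV[R]_n) id.
  apply/eqaddoP => e e0.
  (* Each of the [n] coordinate steps gets an equal share of the error; dividing by [n + 1] instead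
     of [n] covers [n = 0]. *)
  have e1 : 0 < e / n.+1%:R by rewrite divr_gt0 // ltr0n.
  have /nbhs_ballP[r /= r0 Hr] : \forall y \near x, forall i,
      derivable h y (ei R i) /\ `|pd h i x - pd h i y| <= e / n.+1%:R.
    apply: (@filter_forall _ _ (fun i y => derivable h y (ei R i) /\
      `|pd h i x - pd h i y| <= e / n.+1%:R) (nbhs x) _) => i.
    apply: filterI.
      by apply: filterS dh => y; apply.
    by have /cvgrPdist_le := ch i; apply.
  have Hw u : `|u| < r -> forall i,
      derivable h (x + u) (ei R i) /\ `|pd h i x - pd h i (x + u)| <= e / n.+1%:R.
    by move=> ur; apply: Hr; rewrite -ball_normE /= opprD addNKr normrN.
  near=> v.
  have vr : `|v| < r.
    near: v; apply/nbhs_ballP; exists r => // u.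
    by rewrite -ball_normE /= sub0r normrN.
  rewrite /= -[X in `|X|]/(h (v + x) - (h x + d v)).
  pose w (k : nat) : 'rV[R]_n := \row_i (if (i < k)%N then v 0 i else 0).
  have w0 : w 0%N = 0 by apply/rowP => i; rewrite !mxE.
  have wn : w n = v by apply/rowP => i; rewrite !mxE ltn_ord.
  have wS (k : 'I_n) : w k.+1 = w k + v 0 k *: ei R k.
    apply/rowP => i; rewrite !mxE eqxx /= ltnS leq_eqVlt.
    have [/eqP/val_inj->|ik] /= := boolP (val i == val k).
      by rewrite ltnn eqxx mulr1 add0r.
    suff -> : (i == k) = false by rewrite mulr0 addr0.
    by apply/negbTE; apply: contra ik => /eqP->.
  have step (k : 'I_n) : exists2 c, `|pd h k x - c| <= e / n.+1%:R &
      h (x + w k.+1) - h (x + w k) = v 0 k * c.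
    (* The norm is the sup norm, so every point of the path stays within [|v|] of its start, hence
       in the ball. *)
    have ws (s : R) : `|s| <= `|v 0 k| -> `|w k + s *: ei R k| < r.
      move=> sv; apply: le_lt_trans vr; apply: norm_le_coord => // i.
      rewrite !mxE eqxx /=; have [->|ik] := eqVneq i k.
        by rewrite ltnn add0r mulr1 (le_trans sv) // coord_le_norm.
      by rewrite mulr0 addr0; case: ifP; rewrite ?normr0 ?coord_le_norm.
    have [s /ws /Hw/(_ k)[_ sr] E] := @MVT_line _ h (x + w k) (ei R k) (v 0 k)
      (fun s sv => ltac:(rewrite -addrA; exact: (Hw _ (ws s sv) k).1)).
    by exists (pd h k (x + (w k + s *: ei R k))); rewrite // wS !addrA E.
  have -> : h (v + x) - (h x + d v) =
      \sum_(k < n) ((h (x + w k.+1) - h (x + w k)) - v 0 k * pd h k x).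
    rewrite sumrB opprD addrA; congr (_ - _).
    rewrite -(big_mkord xpredT (fun k => h (x + w k.+1) - h (x + w k))).
    by rewrite (telescope_sumr (fun k => h (x + w k))) // wn w0 addr0 [v + x]addrC.
  rewrite (le_trans (ler_norm_sum _ _ _)) //.
  apply: (@le_trans _ _ (\sum_(k < n) (e / n.+1%:R * `|v|))).
    apply: ler_sum => k _; have [c c1 ->] := step k.
    rewrite -mulrBr normrM mulrC ler_pM // ?coord_le_norm //.
    by rewrite distrC.
  rewrite sumr_const card_ord -(mulr_natr _ n).
  have -> : e / n.+1%:R * `|v| * n%:R = e * `|v| * (n%:R / n.+1%:R) by ring.
  have ev : 0 <= e * `|v| by rewrite mulr_ge0 // ltW.
  apply: (le_trans (ler_wpM2l ev (_ : _ <= 1))); last by rewrite mulr1.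
  by rewrite ler_pdivrMr ?ltr0n // mul1r ler_nat.
have dE : 'd h x = dL :> (_ -> _) by apply: diff_unique.
split; last by move=> v; rewrite dE.
by apply/diff_locallyP; rewrite dE.
Unshelve. all: by end_near. Qed.

Lemma dist_half (a b c d e : R) :
  `|a - c| <= e / 2 -> `|b - d| <= e / 2 -> c = d -> `|a - b| <= e.
Proof.
move=> ac bd cd; rewrite (le_trans (ler_distD c a b)) // (splitr e) lerD //.
by rewrite cd distrC.
Qed.

(** Schwarz's theorem: the second difference of [h] over a small square is symmetric in the two
    directions and equals [t^2] times either mixed partial at some nearby point; continuity compares
    both values with those at [x]. *)
Lemma pd_comm n (h : 'rV[R]_n -> R) (x : 'rV[R]_n) (i j : 'I_n) :
  (\forall y \near x, forall k, derivable h y (ei R k)) ->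
  (\forall y \near x, forall k l, derivable (pd h k) y (ei R l)) ->
  {for x, continuous (pd (pd h i) j)} ->
  {for x, continuous (pd (pd h j) i)} ->
  pd (pd h i) j x = pd (pd h j) i x.
Proof.
move=> d1 d2 cij cji; apply/eqP; rewrite -subr_eq0 -normr_eq0 eq_le normr_ge0 andbT.
apply/ler_addgt0Pl => e e0; rewrite addr0.
have e2 : 0 < e / 2 by rewrite divr_gt0.
have /nbhs_ballP[r /= r0 Hr] : \forall y \near x,
    ((forall k, derivable h y (ei R k)) /\
     (forall k l, derivable (pd h k) y (ei R l))) /\
    (`|pd (pd h i) j x - pd (pd h i) j y| <= e / 2 /\
     `|pd (pd h j) i x - pd (pd h j) i y| <= e / 2).
  apply: filterI; first exact: filterI.
  by apply: filterI; [have /cvgrPdist_le := cij|have /cvgrPdist_le := cji]; apply.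
(* With [r / 3], two displacements of length at most [t] along the axes stay strictly inside the
   ball of radius [r]. *)
pose t := r / 3; have t0 : 0 < t by rewrite divr_gt0.
have Hb k l (a b : R) : `|a| <= `|t| -> `|b| <= `|t| ->
    ball x r (x + a *: ei R k + b *: ei R l).
  move=> at_ bt; rewrite -ball_normE /= -addrA opprD addNKr normrN.
  rewrite (le_lt_trans (ler_normD _ _)) // !normrZ.
  have := ler_piMr (normr_ge0 a) (norm_ei_le k).
  have := ler_piMr (normr_ge0 b) (norm_ei_le l).
  move: at_ bt; rewrite (gtr0_norm t0) /t; lra.
have swap (a b c d : R) : a - b - (c - d) = a - c - (b - d) by ring.
have dd k l : exists2 y, ball x r y &
    h (x + t *: ei R k + t *: ei R l) - h (x + t *: ei R l)
    - (h (x + t *: ei R k) - h x) = t * (t * pd (pd h k) l y).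
  (* The increment of [h] in direction [l]: one mean value step on [u] along [k], then another on
     [pd h k] along [l]. *)
  pose u y := h (y + t *: ei R l) - h y.
  have du (s : R) : `|s| <= `|t| -> is_derive (x + s *: ei R k) (ei R k) u
     (pd h k (x + s *: ei R k + t *: ei R l) - pd h k (x + s *: ei R k)).
    move=> st; apply: is_deriveB; last first.
      apply: derivableP; rewrite -[x + _]addr0 -(scale0r (ei R l)).
      by apply: (Hr _ _).1.1; apply: Hb; rewrite // normr0.
    have dl : derivable h (x + s *: ei R k + t *: ei R l) (ei R k).
      by apply: (Hr _ _).1.1; apply: Hb.
    have E : (fun a : R => a^-1 *: (((fun y => h (y + t *: ei R l)) \o
        shift (x + s *: ei R k)) (a *: ei R k) - h (x + s *: ei R k + t *: ei R l))) =
      (fun a : R => a^-1 *: ((h \o shift (x + s *: ei R k + t *: ei R l)) (a *: ei R k)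
         - h (x + s *: ei R k + t *: ei R l))).
      by apply/funext => a /=; rewrite !addrA.
    by split; rewrite /derivable /derive /pd /= E.
  have [s st E1] := @MVT_line _ u x (ei R k) t (fun s st => @ex_derive _ _ _ _ _ _ _ (du s st)).
  have [s' st' E2] := @MVT_line _ (pd h k) (x + s *: ei R k) (ei R l) t
    (fun s' st' => (Hr _ (Hb k l s s' st st')).1.2 k l).
  exists (x + s *: ei R k + s' *: ei R l); first exact: Hb.
  have -> : h (x + t *: ei R k + t *: ei R l) - h (x + t *: ei R l)
    - (h (x + t *: ei R k) - h x) = u (x + t *: ei R k) - u x.
    exact: swap.
  by rewrite E1 (@derive_val _ _ _ _ _ _ _ (du s st)) E2.
have [y yr Ey] := dd i j; have [z zr Ez] := dd j i.
have E : pd (pd h i) j y = pd (pd h j) i z.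
  apply: (mulfI (lt0r_neq0 t0)); apply: (mulfI (lt0r_neq0 t0)).
  apply: (etrans (esym Ey)); apply: etrans Ez.
  by rewrite (addrAC x (t *: ei R j)); exact: swap.
have [_ [Hy _]] := Hr _ yr; have [_ [_ Hz]] := Hr _ zr.
exact: dist_half Hy Hz E.
Qed.

Lemma is_derive_comp n (V : normedModType R) (h : 'rV[R]_n -> R) (phi : V -> 'rV[R]_n)
    (x v : V) :
  (\forall y \near phi x, forall i, derivable h y (ei R i)) ->
  (forall i, {for phi x, continuous (pd h i)}) ->
  (forall i, derivable (fun y => phi y 0 i) x v) ->
  is_derive x v (h \o phi)
    (\sum_i pd h i (phi x) * 'D_v (fun y => phi y 0 i) x).
Proof.
move=> dh ch dphi.
have [Dh Eh] := differentiable_partials dh ch.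
have dp : derivable phi x v by apply/derivable_mxP => i j; rewrite (ord1 i).
(* [phi] is only derivable along [v]; restricted to that line it is a function of one variable, for
   which derivable and differentiable coincide. *)
pose k (s : R) := phi (s *: v + x).
have k0 : k 0 = phi x by rewrite /k scale0r add0r.
have Dk : differentiable k 0.
  by apply/derivable1_diffP; exact: ((derivable1P phi x v).1 dp).
have Dhk : differentiable (h \o k) 0 by apply: differentiable_comp => //; rewrite k0.
split; first by apply/(derivable1P (h \o phi) x v)/derivable1_diffP; exact: Dhk.
have line (W : normedModType R) (w : V -> W) :
    'D_v w x = 'D_1 (fun s : R => w (s *: v + x)) 0.
  have E : (fun a : R => a^-1 *: ((w \o shift x) (a *: v) - w x)) =
    (fun a : R => a^-1 *: (((fun s : R => w (s *: v + x)) \o shift 0) (a *: 1)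
      - w (0 *: v + x))).
    by apply/funext => s /=; rewrite [s *: 1]mulr1 addr0 scale0r add0r.
  by rewrite /derive E.
apply: (etrans (line _ (h \o phi))); apply: (etrans (deriveE _ Dhk)).
rewrite (diff_comp Dk) /=; last by rewrite k0.
rewrite k0 Eh; apply: eq_bigr => i _; rewrite mulrC; congr (_ * _).
have -> : 'd k 0 1 = 'D_v phi x by rewrite (line _ phi) (deriveE _ Dk).
by rewrite derive_mx // mxE.
Qed.

End Calculus.

(** * Derivatives of products, sums, determinants and inverses *)

Section DeriveRules.
Variables (R : realType) (V : normedModType R).
Implicit Types (a b : V -> R) (x v : V).

Lemma is_derive_mul a b x v (da db : R) :
  is_derive x v a da -> is_derive x v b db ->
  is_derive x v (fun y => a y * b y) (da * b x + a x * db).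
Proof.
move=> Da Db; apply: (is_derive_eq (is_deriveM Da Db)).
by rewrite addrC [b x *: da]mulrC.
Qed.

Lemma is_derive_bigsum (I : Type) (r : seq I) (F : I -> V -> R) (dF : I -> R) x v :
  (forall i, is_derive x v (F i) (dF i)) ->
  is_derive x v (fun y => \sum_(i <- r) F i y) (\sum_(i <- r) dF i).
Proof.
move=> DF; elim: r => [|i r IH].
  rewrite big_nil (_ : (fun y => _) = cst 0); first exact: is_derive_cst.
  by apply/funext => y; rewrite big_nil.
rewrite big_cons (_ : (fun y => _) = F i + (fun y => \sum_(j <- r) F j y)).
  exact: is_deriveD.
by apply/funext => y; rewrite big_cons.
Qed.

Lemma derivable_mul a b x v :
  derivable a x v -> derivable b x v -> derivable (fun y => a y * b y) x v.
Proof. exact: derivableM. Qed.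

Lemma derivable_bigsum (I : Type) (r : seq I) (F : I -> V -> R) x v :
  (forall i, derivable (F i) x v) -> derivable (fun y => \sum_(i <- r) F i y) x v.
Proof.
move=> dF; apply: (@ex_derive _ _ _ _ _ _ (\sum_(i <- r) 'D_v (F i) x)).
by apply: is_derive_bigsum => i; apply: derivableP.
Qed.

Lemma derivable_bigprod (I : Type) (r : seq I) (F : I -> V -> R) x v :
  (forall i, derivable (F i) x v) -> derivable (fun y => \prod_(i <- r) F i y) x v.
Proof.
move=> dF; elim: r => [|i r IH].
  rewrite (_ : (fun y => _) = cst 1); first exact: derivable_cst.
  by apply/funext => y; rewrite big_nil.
rewrite (_ : (fun y => _) = fun y => F i y * \prod_(j <- r) F j y).
  exact: derivable_mul.
by apply/funext => y; rewrite big_cons.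
Qed.

Lemma derivable_det n (M : V -> 'M[R]_n) x v :
  (forall i j, derivable (fun y => M y i j) x v) ->
  derivable (fun y => \det (M y)) x v.
Proof.
move=> dM; apply: derivable_bigsum => s; apply: derivable_mul.
  exact: derivable_cst.
exact: derivable_bigprod.
Qed.

(** Cramer's rule makes the entries rational in those of [M]. Invertibility is asked near [x]
    because [invmx] falls back to the matrix itself on singular arguments. *)
Lemma derivable_invmx n (M : V -> 'M[R]_n) x v :
  (\forall y \near x, M y \in unitmx) ->
  (forall i j, derivable (fun y => M y i j) x v) ->
  forall i j, derivable (fun y => invmx (M y) i j) x v.
Proof.
move=> uM dM i j.
apply: (@near_eq_derivable _ _ _ (fun y => (\det (M y))^-1 * \adj (M y) i j)).
  by apply: filterS uM => y uy; rewrite /invmx uy [RHS]mxE.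
apply: derivable_mul.
  apply: derivableV; last exact: derivable_det.
  by have := nbhs_singleton uM; rewrite unitmxE unitfE.
rewrite (_ : (fun y => _) =
  fun y => (-1) ^+ (j + i) * \det (row' j (col' i (M y)))).
  apply: derivable_mul; first exact: derivable_cst.
  apply: derivable_det => k l.
  by rewrite (_ : (fun y => _) = fun y => M y (lift j k) (lift i l)) //;
    apply/funext => y; rewrite !mxE.
by apply/funext => y; rewrite mxE.
Qed.

End DeriveRules.

(** * Closure properties of smooth functions *)

Section Smoothness.
Variable R : realType.

(** Finite-order counterpart of [smooth_on], made so that products and compositions yield to
    induction on the order. It peels off the derivative taken first, which [pds] keeps at the end of
    its list. *)
Fixpoint Ck (k n : nat) (D : set 'rV[R]_n) (h : 'rV[R]_n -> R) : Prop :=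
  if k is k'.+1 then
    (forall x, D x -> {for x, continuous h} /\ forall i, derivable h x (ei R i)) /\
    forall i, Ck k' D (pd h i)
  else forall x, D x -> {for x, continuous h}.

Lemma pds_rcons n (l : seq 'I_n) (i : 'I_n) (h : 'rV[R]_n -> R) :
  pds (rcons l i) h = pds l (pd h i).
Proof. by elim: l => //= j l ->. Qed.

Lemma smooth_on_pd n (D : set 'rV[R]_n) h i :
  smooth_on D h -> smooth_on D (pd h i).
Proof. by move=> sh l; rewrite -pds_rcons; exact: sh. Qed.

Lemma smooth_onP n (D : set 'rV[R]_n) h : smooth_on D h <-> forall k, Ck k D h.
Proof.
split=> [sh k|ch l].
  elim: k h sh => [|k IH] h sh /=; first by move=> x /(sh [::])[].
  by split=> [x /(sh [::])//|i]; apply/IH/smooth_on_pd.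
(* One order more than the length of [l], since [smooth_on] also asks [pds l h] to be derivable. The
   induction removes the last entry of [l], the innermost derivative. *)
have {ch} := ch (size l).+1; elim/last_ind: l h => [|l i IH] h.
  by case.
by rewrite size_rcons pds_rcons => -[_] /(_ i); exact: IH.
Qed.

Lemma Ck_cont k n (D : set 'rV[R]_n) h : Ck k D h ->
  forall x, D x -> {for x, continuous h}.
Proof. by case: k => [//|k [ch _] x /ch[]]. Qed.

Lemma Ck_pred k n (D : set 'rV[R]_n) h : Ck k.+1 D h -> Ck k D h.
Proof.
elim: k h => [|k IH] h; first by case=> ch _ x /ch[].
by move=> [ch dh]; split=> // i; apply: IH.
Qed.

Lemma near_open n (D : set 'rV[R]_n) (P : 'rV[R]_n -> Prop) x :
  open D -> D x -> (forall y, D y -> P y) -> \forall y \near x, P y.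
Proof.
by move=> oD Dx HP; apply: filterS HP _; exact: open_nbhs_nbhs.
Qed.

Lemma eq_pd n (D : set 'rV[R]_n) (W : normedModType R) (h h' : 'rV[R]_n -> W) i x :
  open D -> D x -> (forall y, D y -> h y = h' y) -> pd h i x = pd h' i x.
Proof. move=> oD Dx E; by apply: near_eq_derive; exact: near_open oD Dx E. Qed.

Lemma eq_Ck k n (D : set 'rV[R]_n) h h' : open D ->
  (forall x, D x -> h x = h' x) -> Ck k D h -> Ck k D h'.
Proof.
move=> oD; have cont u u' x : D x -> (forall y, D y -> u y = u' y) ->
    {for x, continuous u} -> {for x, continuous (u' : _ -> R)}.
  move=> Dx E cu; rewrite /prop_for /continuous_at -(E x Dx).
  have H := near_open oD Dx E; apply: cvg_trans cu; exact: near_eq_cvg H.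
elim: k h h' => [|k IH] h h' E; first by move=> ch x Dx; apply: cont (ch x Dx).
move=> [ch dh]; split=> [x Dx|i].
  have [c d] := ch x Dx; split; first exact: cont c.
  by move=> i; apply: near_eq_derivable (d i); exact: near_open oD Dx E.
by apply: IH (dh i) => x Dx; apply: (eq_pd _ oD).
Qed.

Lemma Ck_cst k n (D : set 'rV[R]_n) (c : R) : Ck k D (fun=> c).
Proof.
elim: k c => [|k IH] c; first by move=> x _; exact: cst_continuous.
split=> [x _|i]; first by split=> [|i]; [exact: cst_continuous|exact: derivable_cst].
rewrite (_ : pd _ i = fun=> 0) //.
by apply/funext => x; exact: derive_cst.
Qed.

Lemma Ck_add k n (D : set 'rV[R]_n) h h' : open D ->
  Ck k D h -> Ck k D h' -> Ck k D (fun x => h x + h' x).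
Proof.
move=> oD; elim: k h h' => [|k IH] h h' ch ch'.
  by move=> x Dx; apply: continuousD; [exact: ch|exact: ch'].
case: ch ch' => [ch dh] [ch' dh']; split=> [x Dx|i].
  have [c d] := ch x Dx; have [c' d'] := ch' x Dx.
  by split=> [|i]; [exact: continuousD|exact: derivableD].
apply: (@eq_Ck k _ _ (fun x => pd h i x + pd h' i x)) => //; last first.
  exact: IH (dh i) (dh' i).
by move=> x Dx; rewrite /pd -deriveD //; [exact: (ch x Dx).2|exact: (ch' x Dx).2].
Qed.

Lemma Ck_mul k n (D : set 'rV[R]_n) h h' : open D ->
  Ck k D h -> Ck k D h' -> Ck k D (fun x => h x * h' x).
Proof.
move=> oD; elim: k h h' => [|k IH] h h' Ch Ch'.
  by move=> x Dx; apply: continuousM; [exact: Ch|exact: Ch'].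
case: (Ch) (Ch') => [ch dh] [ch' dh']; split=> [x Dx|i].
  have [c d] := ch x Dx; have [c' d'] := ch' x Dx.
  by split=> [|i]; [exact: continuousM|exact: derivableM].
apply: (@eq_Ck k _ _ (fun x => pd h i x * h' x + h x * pd h' i x)) => //.
  move=> x Dx; apply: esym; apply: derive_val.
  by apply: is_derive_mul; apply: derivableP; [exact: (ch x Dx).2|exact: (ch' x Dx).2].
apply: Ck_add oD _ _.
  exact: IH (dh i) (Ck_pred Ch').
exact: IH (Ck_pred Ch) (dh' i).
Qed.

Lemma Ck_sum k n (D : set 'rV[R]_n) (I : Type) (r : seq I) (F : I -> 'rV[R]_n -> R) :
  open D -> (forall i, Ck k D (F i)) -> Ck k D (fun x => \sum_(i <- r) F i x).
Proof.
move=> oD cF; elim: r => [|i r IH].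
  by apply: (eq_Ck oD _ (Ck_cst k D 0)) => x _; rewrite big_nil.
apply: (@eq_Ck k _ _ (fun x => F i x + \sum_(j <- r) F j x)) => //.
  by move=> x _; rewrite big_cons.
exact: Ck_add.
Qed.

Lemma continuous_at_mx (T : topologicalType) p q (M : T -> 'M[R]_(p, q)) x :
  (forall i j, {for x, continuous (fun y => M y i j)}) -> {for x, continuous M}.
Proof.
move=> cM A [P HP sP]; rewrite /nbhs /=.
apply: (@filterS _ (nbhs x) _ [set y | forall i j, P i j (M y i j)]).
  by move=> y HPy; apply: sP.
apply: (@filter_forall _ _ (fun i y => forall j, P i j (M y i j)) (nbhs x) _) => i.
apply: (@filter_forall _ _ (fun j y => P i j (M y i j)) (nbhs x) _) => j.
exact: cM.
Qed.

Lemma Ck1_is_derive_comp n (V : normedModType R) (D : set 'rV[R]_n) h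
    (phi : V -> 'rV[R]_n) (x v : V) :
  open D -> Ck 1 D h -> D (phi x) ->
  (forall i, derivable (fun y => phi y 0 i) x v) ->
  is_derive x v (h \o phi)
    (\sum_i pd h i (phi x) * 'D_v (fun y => phi y 0 i) x).
Proof.
move=> oD [ch dh] Dx; apply: is_derive_comp.
  by apply: near_open oD Dx _ => y /ch[].
by move=> i; apply: dh.
Qed.

(** The chain rule writes a partial of [h \o phi] as a sum of products in which the factors
    [pd h j \o phi] fall under the induction hypothesis, with [phi] weakened by one order. *)
Lemma Ck_comp k m n (U : set 'rV[R]_m) (D : set 'rV[R]_n) h (phi : 'rV[R]_m -> 'rV[R]_n) :
  open U -> open D -> (forall x, U x -> D (phi x)) ->
  (forall i, Ck k U (fun x => phi x 0 i)) -> Ck k D h -> Ck k U (h \o phi).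
Proof.
move=> oU oD UD; elim: k h => [|k IH] h cphi Ch.
  move=> x Ux; apply: continuous_comp; last exact: Ch (UD _ Ux).
  by apply: continuous_at_mx => i j; rewrite (ord1 i); exact: cphi.
have dphi x i j : U x -> derivable (fun y => phi y 0 j) x (ei R i).
  by move=> Ux; exact: ((cphi j).1 x Ux).2.
have dc x i : U x -> is_derive x (ei R i) (h \o phi)
    (\sum_j pd h j (phi x) * pd (fun y => phi y 0 j) i x).
  move=> Ux; apply: (@Ck1_is_derive_comp _ _ D) => //; last by move=> j; exact: dphi.
    case: Ch => ch dh; split=> // j y Dy; exact: Ck_cont (dh j) _ Dy.
  exact: UD.
split=> [x Ux|i].
  split=> [|i]; last exact: @ex_derive _ _ _ _ _ _ _ (dc x i Ux).
  apply: continuous_comp; last exact: (Ch.1 _ (UD _ Ux)).1.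
  by apply: continuous_at_mx => a j; rewrite (ord1 a); exact: ((cphi j).1 _ Ux).1.
apply: (@eq_Ck k _ _ (fun x => \sum_j (pd h j \o phi) x * pd (fun y => phi y 0 j) i x)) => //.
  by move=> x Ux; apply: esym; exact: (@derive_val _ _ _ _ _ _ _ (dc x i Ux)).
apply: Ck_sum => // j; apply: Ck_mul => //; last exact: (cphi j).2.
by apply: IH (Ch.2 j) => l; exact: Ck_pred.
Qed.

Lemma smooth_mx_comp m n p q (U : set 'rV[R]_m) (D : set 'rV[R]_n)
    (h : 'rV[R]_n -> 'M[R]_(p, q)) (phi : 'rV[R]_m -> 'rV[R]_n) :
  open U -> open D -> (forall x, U x -> D (phi x)) ->
  smooth_mx U phi -> smooth_mx D h -> smooth_mx U (fun x => h (phi x)).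
Proof.
move=> oU oD UD sphi sh i j; apply/smooth_onP => k.
apply: (Ck_comp (h := fun y => h y i j) oU oD UD) => [l|].
  by move/smooth_onP: (sphi 0 l); apply.
by move/smooth_onP: (sh i j); apply.
Qed.

Lemma smooth_mx_mull m p q r (U : set 'rV[R]_m) (A : 'M[R]_(p, q))
    (h : 'rV[R]_m -> 'M[R]_(q, r)) :
  open U -> smooth_mx U h -> smooth_mx U (fun x => A *m h x).
Proof.
move=> oU sh i j; apply/smooth_onP => k.
apply: (@eq_Ck k _ _ (fun x => \sum_l A i l * h x l j)) => //.
  by move=> x _; rewrite mxE.
apply: Ck_sum => // l; apply: Ck_mul => //; first exact: Ck_cst.
by move/smooth_onP: (sh l j); apply.
Qed.

Lemma smooth_on_Ck k n (D : set 'rV[R]_n) h : smooth_on D h -> Ck k D h.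
Proof. by move/smooth_onP. Qed.

Lemma smooth_on_derivable n (D : set 'rV[R]_n) h x i :
  smooth_on D h -> D x -> derivable h x (ei R i).
Proof. by move=> sh /(sh [::])[]. Qed.

Lemma smooth_on_pdC n (D : set 'rV[R]_n) h x i j :
  open D -> smooth_on D h -> D x -> pd (pd h i) j x = pd (pd h j) i x.
Proof.
move=> oD sh Dx; apply: pd_comm.
- by apply: near_open oD Dx _ => y Dy k; apply: smooth_on_derivable sh Dy.
- apply: near_open oD Dx _ => y Dy k l.
  by apply: smooth_on_derivable Dy; exact: smooth_on_pd.
- by have [] := sh [:: j; i] x Dx.
- by have [] := sh [:: i; j] x Dx.
Qed.

End Smoothness.

(** * Duality of two-forms in dimension four *)

Section FourDimensionalDuality.
Variable R : realType.
Local Notation i0 := (@Ordinal 4 0 isT).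
Local Notation i1 := (@Ordinal 4 1 isT).
Local Notation i2 := (@Ordinal 4 2 isT).
Local Notation i3 := (@Ordinal 4 3 isT).

Lemma sum4 (F : 'I_4 -> R) : \sum_i F i = F i0 + F i1 + F i2 + F i3.
Proof.
rewrite !big_ord_recl big_ord0 addr0 !addrA.
by do !congr (_ + _); congr F; apply: val_inj.
Qed.

Lemma all4 (P : 'I_4 -> Prop) : P i0 -> P i1 -> P i2 -> P i3 -> forall i, P i.
Proof.
move=> P0 P1 P2 P3 [[|[|[|[|//]]]] lt];
  by [rewrite (bool_irrelevance lt isT)].
Qed.

(** Entries are indexed by naturals so that the ordinals produced by repeated Laplace expansion
    reduce to numerals and [ring] applies. *)
Lemma det4 (m : nat -> nat -> R) : \det (\matrix_(i < 4, j < 4) m i j) =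
  let d2 (a b c d : nat) := m a c * m b d - m a d * m b c in
  let d3 (a b c : nat) := m 1 a * d2 2 3 b c - m 1 b * d2 2 3 a c + m 1 c * d2 2 3 a b in
  m 0 0 * d3 1 2 3 - m 0 1 * d3 0 2 3 + m 0 2 * d3 0 1 3 - m 0 3 * d3 0 1 2.
Proof.
rewrite (expand_det_row _ ord0) !big_ord_recl big_ord0 /cofactor.
rewrite !(@expand_det_row _ 3 _ ord0) !big_ord_recl !big_ord0 /cofactor.
rewrite !(@expand_det_row _ 2 _ ord0) !big_ord_recl !big_ord0 /cofactor.
rewrite !det_mx11 !mxE /= /bump /= !add0n !addn0 !addnE /=.
rewrite /=; ring.
Qed.

Lemma det4E (M : 'M[R]_4) : \det M =
  let m := M in
  let d2 a b c d := m a c * m b d - m a d * m b c in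
  let d3 a b c := m i1 a * d2 i2 i3 b c - m i1 b * d2 i2 i3 a c + m i1 c * d2 i2 i3 a b in
  m i0 i0 * d3 i1 i2 i3 - m i0 i1 * d3 i0 i2 i3 + m i0 i2 * d3 i0 i1 i3 - m i0 i3 * d3 i0 i1 i2.
Proof.
have -> : M = \matrix_(i < 4, j < 4) M (inord i) (inord j).
  by apply/matrixP => i j; rewrite mxE !inord_val.
rewrite (det4 (fun i j => M (inord i) (inord j))) /= !mxE.
by [].
Qed.

(** The sign is obtained by counting inversions. On literal indices this computes, unlike the
    determinant in [levi], so component identities can be decided by cases. *)
Definition lev (a b c d : nat) : R :=
  if uniq [:: a; b; c; d] then
    (-1) ^+ ((b < a) + (c < a) + (d < a) + (c < b) + (d < b) + (d < c))%N
  else 0.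

Lemma leviE (a b c d : 'I_4) : levi R a b c d = lev a b c d.
Proof.
rewrite /lev; have [abcd|abcd] := boolP (uniq [:: val a; val b; val c; val d]).
  rewrite /levi.
  have -> : \matrix_(i < 4, j < 4) ((tnth [tuple a; b; c; d] i == j)%:R : R) =
      \matrix_(i < 4, j < 4) ((nth 0%N [:: val a; val b; val c; val d] i == j)%:R : R).
    apply/matrixP => i j; rewrite !mxE (tnth_nth a) /= -val_eqE.
    by case: i => [[|[|[|[|]]]]].
  rewrite (det4 (fun i j => (nth 0%N [:: val a; val b; val c; val d] i == j)%:R)).
  case: a b c d abcd => [a la] [b lb] [c lc] [d ld] /=.
  case: a la => [|[|[|[|//]]]] _; case: b lb => [|[|[|[|//]]]] _ //;
  case: c lc => [|[|[|[|//]]]] _ //; case: d ld => [|[|[|[|//]]]] _ // _ /=;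
  rewrite ?(mulr0, mul0r, mulr1, mul1r, addr0, add0r, subr0, oppr0, sub0r) //=;
  by rewrite ?exprS ?expr0 ?(mulr1, mulN1r, opprK, mulrN1).
have alt (i j : 'I_4) : i != j ->
    tnth [tuple a; b; c; d] i = tnth [tuple a; b; c; d] j -> levi R a b c d = 0.
  by move=> ij E; apply: (determinant_alternate ij) => k; rewrite !mxE E.
move: abcd; rewrite /= !inE !val_eqE !negb_and !negbK ?orbF.
rewrite -!orbA => /or4P[/eqP E|/eqP E|/eqP E|/or3P[/eqP E|/eqP E|/eqP E]].
- exact: (alt i0 i1).
- exact: (alt i0 i2).
- exact: (alt i0 i3).
- exact: (alt i1 i2).
- exact: (alt i1 i3).
- exact: (alt i2 i3).
Qed.

End FourDimensionalDuality.

(** * The metric-free duality operator on antisymmetric matrices *)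

Section Duality.
Variable R : realType.
Local Notation i0 := (@Ordinal 4 0 isT).
Local Notation i1 := (@Ordinal 4 1 isT).
Local Notation i2 := (@Ordinal 4 2 isT).
Local Notation i3 := (@Ordinal 4 3 isT).

(** The Euclidean Hodge star on components. Isolating it leaves the metric as a congruence, handled
    by [dual_congr]. *)
Definition dual (M : 'M[R]_4) : 'M[R]_4 :=
  \matrix_(a, b) (2^-1 * \sum_c \sum_d levi R a b c d * M c d).

(** The six independent components of a two-form, on which [dual] acts by a signed permutation. *)
Definition asym6 (a b c d e f : R) : 'M[R]_4 :=
  \matrix_(i < 4, j < 4)
   nth 0 (nth [::] [:: [:: 0; a; b; c]; [:: - a; 0; d; e];
                    [:: - b; - d; 0; f]; [:: - c; - e; - f; 0]] i) j.

Lemma asym6P (M : 'M[R]_4) : M^T = - M ->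
  M = asym6 (M i0 i1) (M i0 i2) (M i0 i3) (M i1 i2) (M i1 i3) (M i2 i3).
Proof.
move=> aM; have E i j : M i j = - M j i.
  by move/matrixP: aM => /(_ j i); rewrite !mxE.
have D i : M i i = 0.
  by apply/eqP; rewrite -[_ == 0](@mulrn_eq0 _ _ 2) mulr2n {1}E addNr.
by apply/matrixP; apply: all4; apply: all4; rewrite !mxE /= ?D // E.
Qed.

Lemma dual_asym6 a b c d e f : dual (asym6 a b c d e f) = asym6 f (- e) d c (- b) a.
Proof.
apply/matrixP; apply: all4; apply: all4; rewrite mxE !sum4 !leviE /lev /= !mxE /=;
rewrite ?(mul0r, mulr0, add0r, addr0) //; by field.
Qed.

Lemma dualK M : M^T = - M -> dual (dual M) = M.
Proof. by move=> /asym6P->; rewrite !dual_asym6 !opprK. Qed.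

Lemma dual_asym M : M^T = - M -> (dual M)^T = - dual M.
Proof.
move=> /asym6P->; rewrite dual_asym6.
by apply/matrixP; apply: all4; apply: all4; rewrite !mxE /= ?oppr0 ?opprK.
Qed.

Lemma dual_scale k M : dual (k *: M) = k *: dual M.
Proof.
apply/matrixP => a b; rewrite !mxE [RHS]mulrCA; congr (_ * _); rewrite mulr_sumr.
apply: eq_bigr => c _; rewrite mulr_sumr; apply: eq_bigr => d _.
by rewrite mxE mulrCA.
Qed.

(** Polarised form of [M^2 + (dual M)^2 = 1/2 tr (M^2)], special to dimension four and checked on
    the six components of each form. The product formula for [star] reduces to it. *)
Lemma mul_dual M N : M^T = - M -> N^T = - N ->
  M *m N + dual N *m dual M = (2^-1 * \tr (M *m N))%:M.
Proof.
move=> /asym6P-> /asym6P->; rewrite !dual_asym6.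
move: (M i0 i1) (M i0 i2) (M i0 i3) (M i1 i2) (M i1 i3) (M i2 i3).
move: (N i0 i1) (N i0 i2) (N i0 i3) (N i1 i2) (N i1 i3) (N i2 i3).
move=> a b c d e f a' b' c' d' e' f'.
apply/matrixP; apply: all4; apply: all4;
rewrite /mxtrace !mxE !sum4 !mxE !sum4 !mxE /= ?mulr1n ?mulr0n; by field.
Qed.

Lemma levi_sum (u v w z : 'I_4 -> R) :
  \sum_a \sum_b \sum_c \sum_d levi R a b c d * (u a * v b * w c * z d) =
  \det (\matrix_(i < 4, j < 4) nth u [:: u; v; w; z] i j).
Proof.
rewrite det4E /= !mxE /= !sum4 !leviE /lev /=.
rewrite ?exprS ?expr0 ?(mul0r, add0r, addr0).
move: (u i0) (u i1) (u i2) (u i3) => u0 u1 u2 u3.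
move: (v i0) (v i1) (v i2) (v i3) => v0 v1 v2 v3.
move: (w i0) (w i1) (w i2) (w i3) => w0 w1 w2 w3.
move: (z i0) (z i1) (z i2) (z i3) => z0 z1 z2 z3.
by ring.
Qed.

(** Both factors on the right are determinants, so their product is the determinant of the matrix
    whose rows are the columns [i, j, k, l] of [h]; [levi_sum] expands exactly that. *)
Lemma levi_mul_det (h : 'M[R]_4) (i j k l : 'I_4) :
  \sum_a \sum_b \sum_c \sum_d levi R a b c d * (h a i * h b j * h c k * h d l) =
  \det h * levi R i j k l.
Proof.
rewrite (levi_sum (h^~ i) (h^~ j) (h^~ k) (h^~ l)) mulrC /levi -(det_tr h).
rewrite -det_mulmx; congr (\det _); apply/matrixP => a b.
rewrite !mxE (bigD1 (tnth [tuple i; j; k; l] a)) //= big1 ?addr0 => [|c].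
  rewrite !mxE (eqxx (tnth _ a)) mul1r (tnth_nth i) /=.
  by case: a => [[|[|[|[|]]]]].
by rewrite !mxE eq_sym => /negbTE->; rewrite mul0r.
Qed.

Lemma exchange_sum4 n (F : 'I_4 -> 'I_4 -> 'I_4 -> 'I_4 -> 'I_n -> R) :
  \sum_a \sum_b \sum_c \sum_d \sum_k F a b c d k =
  \sum_k \sum_a \sum_b \sum_c \sum_d F a b c d k.
Proof.
rewrite [RHS]exchange_big; apply: eq_bigr => a _.
rewrite [RHS]exchange_big; apply: eq_bigr => b _.
by rewrite [RHS]exchange_big; apply: eq_bigr => c _; rewrite exchange_big.
Qed.

(** The Levi-Civita symbol is a tensor density: after full expansion it meets four copies of [h],
    two from each side of the outer congruence and two from the inner one being collected by
    [levi_mul_det] into [\det h]. *)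
Lemma dual_congr (h M : 'M[R]_4) :
  h^T *m dual (h *m M *m h^T) *m h = \det h *: dual M.
Proof.
have N c d : (h *m M *m h^T) c d = \sum_k \sum_l M k l * (h c k * h d l).
  rewrite mxE exchange_big /=; apply: eq_bigr => l _.
  by rewrite !mxE mulr_suml; apply: eq_bigr => k _; rewrite -mulrA mulrCA.
apply/matrixP => i j; rewrite [LHS]mxE.
transitivity (\sum_a \sum_b \sum_c \sum_d \sum_k \sum_l
    2^-1 * (M k l * (levi R a b c d * (h a i * h b j * h c k * h d l)))).
  rewrite exchange_big /=; apply: eq_bigr => b _.
  rewrite mxE mulr_suml; apply: eq_bigr => a _.
  rewrite [dual _ _ _]mxE [h^T _ _]mxE mulr_sumr mulr_sumr mulr_suml.
  apply: eq_bigr => c _; rewrite mulr_sumr mulr_sumr mulr_suml.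
  apply: eq_bigr => d _; rewrite N !mulr_sumr mulr_suml.
  apply: eq_bigr => k _; rewrite !mulr_sumr mulr_suml.
  by apply: eq_bigr => l _; ring.
rewrite exchange_sum4 [RHS]mxE [dual _ _ _]mxE mulrCA !mulr_sumr.
apply: eq_bigr => k _; rewrite exchange_sum4 !mulr_sumr; apply: eq_bigr => l _.
rewrite [levi _ _ _ _ _ * _]mulrC [_ * (M k l * _)]mulrCA -levi_mul_det !mulr_sumr.
apply: eq_bigr => a _; rewrite !mulr_sumr; apply: eq_bigr => b _.
by rewrite !mulr_sumr; apply: eq_bigr => c _; rewrite !mulr_sumr.
Qed.

End Duality.

(** * The Hodge star of a Lorentzian metric at a point *)

Section HodgeAlgebra.
Variables (R : realType) (g : 'M[R]_4).
Hypotheses (gsym : g^T = g) (gdet : \det g < 0).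
Local Notation h := (invmx g).
Local Notation s := (Num.sqrt `|\det g|).
Implicit Types M N : 'M[R]_4.

Definition star M := s *: dual (h *m M *m h^T).
Definition pairing M N := \sum_(p < 4) \sum_(q < 4) \sum_(r < 4) \sum_(t < 4)
  M p q * h p r * h q t * N r t.

Let gU : g \in unitmx.
Proof. by rewrite unitmxE unitfE lt_eqF. Qed.

Lemma invmx_sym : h^T = h.
Proof. by rewrite trmx_inv gsym. Qed.

Let sN0 : s != 0.
Proof. by rewrite gt_eqF // sqrtr_gt0 normr_gt0 lt_eqF. Qed.

Let s2 : s * s = - \det g.
Proof. by rewrite -expr2 sqr_sqrtr // ltr0_norm. Qed.

Let conj_asym M : M^T = - M -> (h *m M *m h^T)^T = - (h *m M *m h^T).
Proof. by move=> aM; rewrite !trmx_mul trmxK aM mulmxA mulmxN mulNmx. Qed.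

Lemma star_asym M : M^T = - M -> (star M)^T = - star M.
Proof. by move=> aM; rewrite linearZ /= dual_asym ?scalerN //; exact: conj_asym. Qed.

(** [dual_congr] moves the metric outside the dual at the cost of [\det h], and
    [s / \det g = - 1 / s] because [s^2 = - \det g]. Combining this form with the definition of
    [star] makes the factors [s] cancel in products. *)
Lemma star_lower M : star M = - s^-1 *: (g *m dual M *m g).
Proof.
have := dual_congr h M; rewrite invmx_sym => E.
rewrite /star invmx_sym.
have -> : dual (h *m M *m h) = \det h *: (g *m dual M *m g).
  rewrite scalemxAl scalemxAr -E -!mulmxA mulVmx // mulmx1.
  by rewrite mulKVmx.
rewrite scalerA det_inv; congr (_ *: _).
have quot (a d : R) : a != 0 -> a * a = - d -> a / d = - a^-1.
  by move=> a0 E1; rewrite -[d]opprK -E1; field.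
exact: quot.
Qed.

(** With the definition outside and [star_lower] inside, the metric cancels and only
    [- dual (dual M)] remains; the sign is the Lorentzian one. *)
Lemma starK M : M^T = - M -> star (star M) = - M.
Proof.
move=> aM; rewrite {1}/star star_lower invmx_sym.
rewrite -scalemxAr -scalemxAl dual_scale scalerA mulrN divff // scaleN1r.
by rewrite !mulmxA mulVmx // mul1mx mulmxK // dualK.
Qed.

(** With the definition for [M] and [star_lower] for [N], what remains is [mul_dual] applied to [N]
    and the raised form [h M h]. *)
Lemma star_mul M N : M^T = - M -> N^T = - N ->
  star M *m h *m star N = N *m h *m M - (2^-1 * \tr (N *m h *m M *m h)) *: g.
Proof.
move=> aM aN; rewrite (star_lower N) /star.
have := mul_dual aN (conj_asym aM); rewrite invmx_sym => E.
rewrite -scalemxAr -!scalemxAl scalerA mulNr mulVf // scaleN1r.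
rewrite !mulmxA mulmxKV // -mulNmx.
have -> : - (dual (h *m M *m h) *m dual N) =
    N *m (h *m M *m h) - (2^-1 * \tr (N *m (h *m M *m h)))%:M.
  by rewrite -E opprD addNKr.
by rewrite mulmxBl !mulmxA mulmxKV // mul_scalar_mx.
Qed.

(** The sign appears because a trace contracts indices cyclically, which transposes the second
    form. *)
Lemma pairingE M N : N^T = - N -> pairing M N = - \tr (M *m h *m N *m h).
Proof.
move=> aN; have -> : - \tr (M *m h *m N *m h) = \tr (M *m (h *m N *m h^T)^T).
  by rewrite !trmx_mul trmxK aN invmx_sym !mulmxA mulmxN mulNmx linearN.
apply: eq_bigr => p _; rewrite mxE; apply: eq_bigr => q _.
rewrite !mxE mulr_sumr exchange_big /=; apply: eq_bigr => r _.
rewrite !mxE mulr_suml mulr_sumr; apply: eq_bigr => t _.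
by rewrite -!mulrA; do 2 congr (_ * _); rewrite mulrC.
Qed.

Lemma pairingNr M N : pairing M (- N) = - pairing M N.
Proof.
rewrite /pairing -sumrN; apply: eq_bigr => p _; rewrite -sumrN; apply: eq_bigr => q _.
rewrite -sumrN; apply: eq_bigr => r _; rewrite -sumrN; apply: eq_bigr => t _.
by rewrite mxE mulrN.
Qed.

(** This is the trace of [star_mul]: since the identity has trace 4, the coefficient is
    [1 - 4 / 2 = -1]. *)
Lemma pairing_star_star M N : M^T = - M -> N^T = - N ->
  pairing (star M) (star N) = - pairing M N.
Proof.
move=> aM aN; rewrite !pairingE ?star_asym // star_mul // mulmxBl -scalemxAl.
rewrite mulmxV // linearB /= linearZ /= mxtrace1.
have -> : \tr (N *m h *m M *m h) = \tr (M *m h *m N *m h).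
  by rewrite -mulmxA mxtrace_mulC mulmxA.
by move: (\tr _) => t; field.
Qed.

(** Self-adjointness is formal once [star] squares to [-1] and reverses the sign of the pairing. *)
Lemma pairing_starC M N : M^T = - M -> N^T = - N ->
  pairing (star M) N = pairing M (star N).
Proof.
move=> aM aN; have aS := star_asym aN.
have <- : pairing (star M) (- star (star N)) = pairing (star M) N.
  by rewrite starK // opprK.
have -> : pairing (star M) (- star (star N)) = - pairing (star M) (star (star N)).
  by rewrite pairingNr.
by rewrite pairing_star_star // opprK.
Qed.

End HodgeAlgebra.

Section HodgeForms.
Variable R : realType.

(** Determinants of the diagonalisation give [det(P)^2 det(g) = -1]. *)
Lemma lorentzian_det (U : set 'rV[R]_4) g x : lorentzian U g -> U x ->
  (g x)^T = g x /\ \det (g x) < 0.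
Proof.
move=> [_ lg] /lg[gs [P [uP E]]]; split=> //.
have := congr1 determinant E; rewrite !det_mulmx det_tr det_diag.
rewrite !big_ord_recl big_ord0 !mxE /= !mulr1 => E1.
have P0 : \det P != 0 by rewrite -unitfE -unitmxE.
have P2 : 0 < \det P * \det P by rewrite -expr2 exprn_even_gt0.
rewrite -(pmulr_rlt0 _ P2); have -> : \det P * \det P * \det (g x) = -1.
  by rewrite -E1; ring.
by rewrite oppr_lt0.
Qed.

Definition fmx k (F : form2 R k) (x : 'rV[R]_4) (L : 'I_k) : 'M[R]_4 :=
  \matrix_(a, b) F a b x L 0.

Lemma fmx_asym k (F : form2 R k) x L :
  (forall a b x, F a b x = - F b a x) -> (fmx F x L)^T = - fmx F x L.
Proof. by move=> aF; apply/matrixP => a b; rewrite !mxE aF mxE. Qed.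

Lemma hodge_fmx k g (F : form2 R k) x L :
  fmx (hodge g F) x L = star (g x) (fmx F x L).
Proof.
apply/matrixP => a b.
rewrite [LHS]mxE [LHS]mxE [RHS]mxE [dual _ _ _]mxE mulrA [_ * 2^-1]mulrC.
congr (_ * _); rewrite summxE; apply: eq_bigr => c _.
rewrite summxE; apply: eq_bigr => d _.
rewrite exchange_big summxE mxE mulr_sumr; apply: eq_bigr => f _.
rewrite summxE !mxE mulr_suml mulr_sumr; apply: eq_bigr => e _.
by rewrite !mxE /ginv; ring.
Qed.

End HodgeForms.

(** * Taming maps and the source terms *)

Section Taming.
Variables (R : realType) (nv : nat).
Implicit Types (K : 'M[R]_(nv + nv)) (v w : 'cV[R]_(nv + nv)).

Lemma omegaE v w : omega v w =
  ((dsubmx v)^T *m usubmx w - (usubmx v)^T *m dsubmx w) 0 0.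
Proof.
rewrite /omega sumrB !mxE; congr (_ - _);
  by apply: eq_bigr => a _; rewrite !mxE.
Qed.

Lemma omegaNr v w : omega v (- w) = - omega v w.
Proof. by rewrite /omega -sumrN; apply: eq_bigr => a _; rewrite !mxE !mulrN opprB opprK addrC. Qed.

Lemma omegaC v w : omega v w = - omega w v.
Proof.
rewrite /omega -sumrN; apply: eq_bigr => a _.
by rewrite opprB ![w _ _ * _]mulrC.
Qed.

Definition tame K :=
  K *m K = - 1%:M /\
  (forall v w, omega (K *m v) (K *m w) = omega v w) /\
  (forall v, v != 0 -> 0 < omega v (K *m v)).

Local Notation Im K := (invmx (ursubmx K)).
Local Notation Rm K := (- (Im K *m ulsubmx K)).

(** Invariance together with [K^2 = -1] moves [K] to the other argument up to a sign, which
    antisymmetry of [omega] absorbs. The symmetries of the blocks of [K] are this identity on basis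
    vectors. *)
Lemma tame_omega_sym K v w : tame K -> omega v (K *m w) = omega w (K *m v).
Proof.
move=> [K2 [Ks _]]; rewrite -Ks mulmxA K2 mulNmx mul1mx omegaNr.
by rewrite omegaC opprK.
Qed.

Lemma entry_delta p q (M : 'M[R]_(p, q)) i j :
  ((delta_mx i 0 : 'cV[R]_p)^T *m M *m (delta_mx j 0 : 'cV[R]_q)) 0 0 = M i j.
Proof. by rewrite trmx_delta -rowE -colE !mxE. Qed.

Lemma tame_ur_sym K : tame K -> (ursubmx K)^T = ursubmx K.
Proof.
move=> tK; apply/matrixP => i j; rewrite mxE.
have := tame_omega_sym (col_mx 0 (delta_mx j 0)) (col_mx 0 (delta_mx i 0)) tK.
rewrite !omegaE -{1 2 3 4}[K]submxK !mul_block_col !col_mxKu !col_mxKd.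
by rewrite !mulmx0 !trmx0 !mul0mx !add0r !subr0 !mulmxA !entry_delta.
Qed.

Lemma tame_ul_tr K : tame K -> (ulsubmx K)^T = - drsubmx K.
Proof.
move=> tK; apply/matrixP => i j; rewrite !mxE.
have := tame_omega_sym (col_mx (delta_mx i 0) 0) (col_mx 0 (delta_mx j 0)) tK.
rewrite !omegaE -{1 2 3 4}[K]submxK !mul_block_col !col_mxKu !col_mxKd.
rewrite !mulmx0 !trmx0 !mul0mx !add0r !addr0 !subr0 !mulmxA.
by rewrite [X in X = _]mxE !entry_delta !mxE => <-.
Qed.

(** On vectors [(0, x)] positivity reads [x^T b x > 0] for the upper right block [b], which
    therefore has no kernel. Hence the [invmx] defining [Imat] is a genuine inverse. *)
Lemma tame_ur_unit K : tame K -> ursubmx K \in unitmx.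
Proof.
move=> tK; rewrite unitmxE unitfE; apply/det0P => -[v v0 Ev].
have x0 : col_mx 0 v^T != 0 :> 'cV[R]_(nv + nv).
  by rewrite col_mx_eq0 eqxx /= trmx_eq0.
have := tK.2.2 _ x0; rewrite omegaE -{1 2}[K]submxK !mul_block_col !col_mxKu !col_mxKd.
by rewrite !mulmx0 !trmx0 !mul0mx !add0r subr0 trmxK mulmxA Ev mul0mx mxE ltxx.
Qed.

Lemma tame_Im_sym K : tame K -> (Im K)^T = Im K.
Proof. by move=> tK; rewrite trmx_inv tame_ur_sym. Qed.

Lemma tame_square K : tame K ->
  ulsubmx K *m ulsubmx K + ursubmx K *m dlsubmx K = - 1%:M /\
  ulsubmx K *m ursubmx K + ursubmx K *m drsubmx K = 0.
Proof.
move=> [K2 _]; move: K2; rewrite -{1 2}[K]submxK mulmx_block.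
rewrite scalar_mx_block opp_block_mx oppr0 => /eq_block_mx[-> -> _ _].
by [].
Qed.

Lemma tame_ul K : tame K -> ulsubmx K = - (ursubmx K *m Rm K).
Proof. by move=> tK; rewrite mulmxN opprK mulKVmx // tame_ur_unit. Qed.

Lemma tame_dr K : tame K -> drsubmx K = Rm K *m ursubmx K.
Proof.
move=> tK; have [_ /eqP] := tame_square tK; rewrite addrC addr_eq0 => /eqP E.
by rewrite mulNmx -mulmxA -mulmxN -E mulKmx // tame_ur_unit.
Qed.

Lemma tame_Rm_sym K : tame K -> (Rm K)^T = Rm K.
Proof.
move=> tK; rewrite {1}linearN /= trmx_mul tame_ul_tr // tame_Im_sym // mulNmx opprK.
by rewrite tame_dr // mulmxK // tame_ur_unit.
Qed.

(** The upper left block of [K^2 = -1], solved for the lower left block. With [tame_ul] and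
    [tame_dr] this recovers the block form of a taming map in terms of [I] and [R]. *)
Lemma tame_dl K : tame K ->
  dlsubmx K = - Im K - Rm K *m ursubmx K *m Rm K.
Proof.
move=> tK; have [/eqP] := tame_square tK; rewrite addrC eq_sym -subr_eq => /eqP E _.
have := congr1 (mulmx (Im K)) E; rewrite mulKmx ?tame_ur_unit // => <-.
have -> : Im K *m (- 1%:M - ulsubmx K *m ulsubmx K) =
    - Im K - Im K *m (ulsubmx K *m ulsubmx K) by rewrite mulmxBr mulmxN mulmx1.
congr (_ - _).
have -> : Rm K *m ursubmx K *m Rm K = Rm K *m - ulsubmx K.
  by rewrite {4}(tame_ul tK) opprK -mulmxA.
by rewrite mulmxN mulNmx opprK mulmxA.
Qed.

Lemma usubmx_mul K v :
  usubmx (K *m v) = ulsubmx K *m usubmx v + ursubmx K *m dsubmx v.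
Proof. by rewrite -{1}[K]submxK -{1}[v]vsubmxK mul_block_col col_mxKu. Qed.

Lemma dsubmx_mul K v :
  dsubmx (K *m v) = dlsubmx K *m usubmx v + drsubmx K *m dsubmx v.
Proof. by rewrite -{1}[K]submxK -{1}[v]vsubmxK mul_block_col col_mxKd. Qed.

(** Here [w] stands for the Hodge dual of [v]: twisted self-duality becomes [H = R F - I *F]. *)
Lemma tame_dsub K v w : tame K -> w = - (K *m v) ->
  dsubmx v = Rm K *m usubmx v - Im K *m usubmx w.
Proof.
move=> tK ->; rewrite linearN /= usubmx_mul.
rewrite mulmxN opprK mulmxDr mulKmx ?tame_ur_unit // mulNmx !mulmxA.
by rewrite addKr.
Qed.

Lemma tame_dsub_dual K v w : tame K -> w = - (K *m v) ->
  dsubmx w = Rm K *m usubmx w + Im K *m usubmx v.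
Proof.
move=> tK E; have Ev : - v = - (K *m w).
  by rewrite E mulmxN opprK mulmxA tK.1 mulNmx mul1mx.
have := tame_dsub tK Ev; rewrite linearN /= => ->.
by rewrite mulmxN opprK.
Qed.

Lemma tr_mulmx11 (x y : 'cV[R]_nv) (M : 'M[R]_nv) :
  (x^T *m M *m y) 0 0 = \sum_L \sum_S M L S * (x L 0 * y S 0).
Proof.
rewrite mxE exchange_big /=; apply: eq_bigr => S _.
rewrite mxE mulr_suml; apply: eq_bigr => L _; rewrite mxE.
by rewrite mulrAC [RHS]mulrC.
Qed.

(** Self-duality replaces [K v'] by [- w']; after both lower halves are eliminated, the [R] terms
    cancel because [R] is symmetric. *)
Lemma tame_omega K v v' w w' : tame K -> w = - (K *m v) -> w' = - (K *m v') ->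
  omega v (K *m v') =
  \sum_L \sum_S Im K L S * (usubmx w L 0 * usubmx w' S 0 + usubmx v L 0 * usubmx v' S 0).
Proof.
move=> tK Ew Ew'; have -> : K *m v' = - w' by rewrite Ew' opprK.
rewrite omegaNr omegaE (tame_dsub tK Ew) (tame_dsub_dual tK Ew').
transitivity (((usubmx w)^T *m Im K *m usubmx w' + (usubmx v)^T *m Im K *m usubmx v') 0 0).
  rewrite linearB /= !trmx_mul tame_Rm_sym // tame_Im_sym //.
  rewrite mulmxBl mulmxDr !mulmxA opprD addrACA subrr add0r !mxE opprB opprK addrC.
  by rewrite addrC.
rewrite mxE !tr_mulmx11 -big_split; apply: eq_bigr => L _.
by rewrite -big_split; apply: eq_bigr => S _ /=; rewrite mulrDr.
Qed.

(* DK, DI, DR stand for the derivatives of K, Im K, Rm K: the hypotheses are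
   the differentiated block identities. *)
Lemma tame_omega_deriv K v v' w w' (DK : 'M[R]_(nv + nv)) (DI DR : 'M[R]_nv) :
  tame K -> w = - (K *m v) -> w' = - (K *m v') ->
  DI *m ursubmx K + Im K *m ursubmx DK = 0 ->
  ulsubmx DK = - (ursubmx DK *m Rm K + ursubmx K *m DR) ->
  drsubmx DK = DR *m ursubmx K + Rm K *m ursubmx DK ->
  dlsubmx DK = - DI - ((DR *m ursubmx K + Rm K *m ursubmx DK) *m Rm K
                       + Rm K *m ursubmx K *m DR) ->
  omega v (DK *m v') =
  \sum_L \sum_S DR L S * (usubmx w L 0 * usubmx v' S 0 + usubmx v L 0 * usubmx w' S 0) +
  \sum_L \sum_S DI L S * (usubmx v L 0 * usubmx v' S 0 - usubmx w L 0 * usubmx w' S 0).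
Proof.
move=> tK Ew Ew' EI Ea Ed Ec.
have bU := tame_ur_unit tK; have Rs := tame_Rm_sym tK; have Is := tame_Im_sym tK.
have E1 : ursubmx DK *m Im K = - (ursubmx K *m DI).
  move/eqP: EI; rewrite addrC addr_eq0 => /eqP EI.
  by rewrite -[ursubmx DK](mulKVmx bU) EI !mulmxN mulNmx -!mulmxA mulmxV // mulmx1.
(* In the upper half the terms with undifferentiated [Rm K] cancel, so only [DI] and [DR]
   survive. *)
have Eu : usubmx (DK *m v') = ursubmx K *m (DI *m usubmx w' - DR *m usubmx v').
  rewrite usubmx_mul (tame_dsub tK Ew') Ea.
  rewrite mulmxBr !mulmxA E1 !mulNmx opprK mulmxDl opprD mulmxBr !mulmxA.
  by rewrite [- _ - _]addrC -addrA addKr addrC.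
set P := DR *m ursubmx K + Rm K *m ursubmx DK in Ec Ed.
have PI : P *m Im K = DR - Rm K *m ursubmx K *m DI.
  by rewrite mulmxDl mulmxK // -[_ *m ursubmx DK *m _]mulmxA E1 mulmxN mulmxA.
(* The lower half is expressed relative to [Rm K] times the upper one, because that common part
   drops out of [omega v] by symmetry of [Rm K]. *)
have Ed' : dsubmx (DK *m v') = Rm K *m usubmx (DK *m v')
    - (DI *m usubmx v' + DR *m usubmx w').
  rewrite Eu dsubmx_mul (tame_dsub tK Ew') Ec Ed.
  rewrite (mulmxBr P) !mulmxA PI [in RHS]mulmxBr !mulmxA.
  rewrite !(mulmxBl, mulmxDl, mulNmx (DI)).
  move: (DR *m _ *m _ *m usubmx v') (_ *m ursubmx DK *m _ *m usubmx v') (DI *m usubmx v')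
    (DR *m usubmx w') (_ *m _ *m DI *m usubmx w') (_ *m _ *m DR *m usubmx v').
  move=> t1 t2 t3 t4 t5 t6.
  by apply/matrixP => i j; rewrite !mxE; ring.
have IU : Im K *m usubmx (DK *m v') = DI *m usubmx w' - DR *m usubmx v'.
  by rewrite Eu mulKmx.
transitivity ((((usubmx w)^T *m DR *m usubmx v') 0 0 +
    ((usubmx v)^T *m DR *m usubmx w') 0 0) +
   (((usubmx v)^T *m DI *m usubmx v') 0 0 - ((usubmx w)^T *m DI *m usubmx w') 0 0)).
  rewrite omegaE Ed' (tame_dsub tK Ew) linearB /= !trmx_mul Rs Is.
  rewrite [X in X - _]mulmxBl -[(usubmx w)^T *m Im K *m _]mulmxA IU.
  rewrite !(mulmxBr, mulmxDr) [(usubmx w)^T *m - _]mulmxN !mulmxA.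
  move: (_ *m DR *m _) (_ *m DR *m _) (_ *m DI *m _) (_ *m DI *m _) (_ *m _ *m usubmx (DK *m v')).
  by move=> t1 t2 t3 t4 t5; rewrite !mxE; ring.
rewrite !tr_mulmx11; congr (_ + _).
  rewrite -big_split; apply: eq_bigr => L _; rewrite -big_split; apply: eq_bigr => S _ /=.
  by rewrite mulrDr.
rewrite -sumrB; apply: eq_bigr => L _; rewrite -sumrB; apply: eq_bigr => S _ /=.
by rewrite mulrBr.
Qed.

End Taming.

(** * Entrywise partial derivatives of matrix-valued maps *)

Section MatrixDerivative.
Variables (R : realType) (n : nat).
Implicit Types (D : set 'rV[R]_n) (k : 'I_n) (y : 'rV[R]_n).

Definition pdmx p q (M : 'rV[R]_n -> 'M[R]_(p, q)) k y : 'M[R]_(p, q) :=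
  \matrix_(i, j) pd (fun z => M z i j) k y.

Definition derivable_entries p q (M : 'rV[R]_n -> 'M[R]_(p, q)) y k :=
  forall i j, derivable (fun z => M z i j) y (ei R k).

Lemma is_derive_entry_mul p q r (M : 'rV[R]_n -> 'M[R]_(p, q))
    (N : 'rV[R]_n -> 'M[R]_(q, r)) k y i j :
  derivable_entries M y k -> derivable_entries N y k ->
  is_derive y (ei R k) (fun z => (M z *m N z) i j)
    ((pdmx M k y *m N y + M y *m pdmx N k y) i j).
Proof.
move=> dM dN.
rewrite (_ : (fun z => _) = fun z => \sum_l M z i l * N z l j); last first.
  by apply/funext => z; rewrite mxE.
rewrite !mxE -big_split /=; apply: is_derive_bigsum => l.
by rewrite [pdmx M k y i l]mxE [pdmx N k y l j]mxE; apply: is_derive_mul; apply: derivableP.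
Qed.

Lemma derivable_entries_mul p q r (M : 'rV[R]_n -> 'M[R]_(p, q))
    (N : 'rV[R]_n -> 'M[R]_(q, r)) k y :
  derivable_entries M y k -> derivable_entries N y k ->
  derivable_entries (fun z => M z *m N z) y k.
Proof. by move=> dM dN i j; case: (is_derive_entry_mul i j dM dN). Qed.

Lemma pdmx_mul p q r (M : 'rV[R]_n -> 'M[R]_(p, q)) (N : 'rV[R]_n -> 'M[R]_(q, r)) k y :
  derivable_entries M y k -> derivable_entries N y k ->
  pdmx (fun z => M z *m N z) k y = pdmx M k y *m N y + M y *m pdmx N k y.
Proof.
move=> dM dN; apply/matrixP => i j; rewrite [LHS]mxE.
exact: (@derive_val _ _ _ _ _ _ _ (is_derive_entry_mul i j dM dN)).
Qed.

Lemma derivable_entries_opp p q (M : 'rV[R]_n -> 'M[R]_(p, q)) k y :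
  derivable_entries M y k -> derivable_entries (fun z => - M z) y k.
Proof.
move=> dM i j; rewrite (_ : (fun z => _) = - (fun z => M z i j)).
  exact: derivableN.
by apply/funext => z; rewrite mxE.
Qed.

Lemma pdmx_opp p q (M : 'rV[R]_n -> 'M[R]_(p, q)) k y :
  derivable_entries M y k -> pdmx (fun z => - M z) k y = - pdmx M k y.
Proof.
move=> dM; apply/matrixP => i j; rewrite !mxE.
rewrite (_ : (fun z => _) = - (fun z => M z i j)); first exact: deriveN.
by apply/funext => z; rewrite mxE.
Qed.

Lemma pdmx_sub p q (M N : 'rV[R]_n -> 'M[R]_(p, q)) k y :
  derivable_entries M y k -> derivable_entries N y k ->
  pdmx (fun z => M z - N z) k y = pdmx M k y - pdmx N k y.
Proof.
move=> dM dN; apply/matrixP => i j; rewrite !mxE.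
rewrite (_ : (fun z => _) = (fun z => M z i j) - (fun z => N z i j)).
  exact: deriveB.
by apply/funext => z; rewrite !mxE.
Qed.

Lemma pdmx_cst p q (M : 'M[R]_(p, q)) k y : pdmx (fun=> M) k y = 0.
Proof. by apply/matrixP => i j; rewrite !mxE; exact: derive_cst. Qed.

Lemma eq_pdmx p q D (M N : 'rV[R]_n -> 'M[R]_(p, q)) k y :
  open D -> D y -> (forall z, D z -> M z = N z) -> pdmx M k y = pdmx N k y.
Proof.
move=> oD Dy E; apply/matrixP => i j; rewrite !mxE.
by apply: (eq_pd _ oD Dy) => z /E->.
Qed.

Lemma ulsubmx_pdmx p q r s (M : 'rV[R]_n -> 'M[R]_(p + q, r + s)) k y :
  ulsubmx (pdmx M k y) = pdmx (fun z => ulsubmx (M z)) k y.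
Proof.
apply/matrixP => i j; rewrite !mxE; congr (pd _ k y).
by apply/funext => z; rewrite !mxE.
Qed.

Lemma ursubmx_pdmx p q r s (M : 'rV[R]_n -> 'M[R]_(p + q, r + s)) k y :
  ursubmx (pdmx M k y) = pdmx (fun z => ursubmx (M z)) k y.
Proof.
apply/matrixP => i j; rewrite !mxE; congr (pd _ k y).
by apply/funext => z; rewrite !mxE.
Qed.

Lemma dlsubmx_pdmx p q r s (M : 'rV[R]_n -> 'M[R]_(p + q, r + s)) k y :
  dlsubmx (pdmx M k y) = pdmx (fun z => dlsubmx (M z)) k y.
Proof.
apply/matrixP => i j; rewrite !mxE; congr (pd _ k y).
by apply/funext => z; rewrite !mxE.
Qed.

Lemma drsubmx_pdmx p q r s (M : 'rV[R]_n -> 'M[R]_(p + q, r + s)) k y :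
  drsubmx (pdmx M k y) = pdmx (fun z => drsubmx (M z)) k y.
Proof.
apply/matrixP => i j; rewrite !mxE; congr (pd _ k y).
by apply/funext => z; rewrite !mxE.
Qed.

Lemma pdmx_tr p q (M : 'rV[R]_n -> 'M[R]_(p, q)) k y :
  pdmx (fun z => (M z)^T) k y = (pdmx M k y)^T.
Proof.
apply/matrixP => i j; rewrite !mxE; congr (pd _ k y).
by apply/funext => z; rewrite mxE.
Qed.

End MatrixDerivative.

(** * Derivatives of the block form of a taming map *)

Section TamingMap.
Variables (R : realType) (ns nv : nat) (V : set 'rV[R]_ns).
Variable J : 'rV[R]_ns -> 'M[R]_(nv + nv).
Hypotheses (oV : open V) (tJ : taming V J).

Lemma taming_tame y : V y -> tame (J y).
Proof. by case: tJ => _; apply. Qed.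

Let dJ y k : V y -> derivable_entries J y k.
Proof. by move=> Vy i j; have [sJ _] := tJ; exact: smooth_on_derivable (sJ i j) Vy. Qed.

Let dul y k : V y -> derivable_entries (fun z => ulsubmx (J z)) y k.
Proof.
move=> Vy i j; rewrite (_ : (fun z => _) = fun z => J z (lshift nv i) (lshift nv j)).
  exact: dJ.
by apply/funext => z; rewrite !mxE.
Qed.

Let dur y k : V y -> derivable_entries (fun z => ursubmx (J z)) y k.
Proof.
move=> Vy i j; rewrite (_ : (fun z => _) = fun z => J z (lshift nv i) (rshift nv j)).
  exact: dJ.
by apply/funext => z; rewrite !mxE.
Qed.

Let dI y k : V y -> derivable_entries (Imat J) y k.
Proof.
move=> Vy; apply: derivable_invmx; last exact: dur.
by apply: (near_open oV Vy) => z Vz; apply/tame_ur_unit/taming_tame.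
Qed.

Let dR y k : V y -> derivable_entries (Rmat J) y k.
Proof.
move=> Vy; apply: derivable_entries_opp; apply: derivable_entries_mul.
  exact: dI.
exact: dul.
Qed.

(** Differentiating [I b = 1] on the open set [V] avoids any explicit formula for the derivative of
    the inverse. *)
Lemma pdmx_Imat y k : V y ->
  pdmx (Imat J) k y *m ursubmx (J y) + Imat J y *m ursubmx (pdmx J k y) = 0.
Proof.
move=> Vy; rewrite ursubmx_pdmx.
rewrite -(pdmx_mul (@dI y k Vy) (@dur y k Vy)).
rewrite (eq_pdmx (N := fun=> 1%:M) _ oV) ?pdmx_cst // => z Vz.
by rewrite mulVmx //; apply/tame_ur_unit/taming_tame.
Qed.

Lemma pdmx_ul y k : V y -> ulsubmx (pdmx J k y) =
  - (ursubmx (pdmx J k y) *m Rmat J y + ursubmx (J y) *m pdmx (Rmat J) k y).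
Proof.
move=> Vy; rewrite ursubmx_pdmx.
rewrite ulsubmx_pdmx.
have d := derivable_entries_mul (@dur y k Vy) (@dR y k Vy).
rewrite -(pdmx_mul (@dur y k Vy) (@dR y k Vy)) -(pdmx_opp d).
by apply: (eq_pdmx _ oV Vy) => z Vz; apply/tame_ul/taming_tame.
Qed.

Lemma pdmx_dr y k : V y -> drsubmx (pdmx J k y) =
  pdmx (Rmat J) k y *m ursubmx (J y) + Rmat J y *m ursubmx (pdmx J k y).
Proof.
move=> Vy; rewrite ursubmx_pdmx.
rewrite drsubmx_pdmx.
rewrite -(pdmx_mul (@dR y k Vy) (@dur y k Vy)).
by apply: (eq_pdmx _ oV Vy) => z Vz; apply/tame_dr/taming_tame.
Qed.

Lemma pdmx_dl y k : V y -> dlsubmx (pdmx J k y) = - pdmx (Imat J) k y -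
  ((pdmx (Rmat J) k y *m ursubmx (J y) + Rmat J y *m ursubmx (pdmx J k y)) *m Rmat J y
   + Rmat J y *m ursubmx (J y) *m pdmx (Rmat J) k y).
Proof.
move=> Vy; rewrite ursubmx_pdmx.
rewrite dlsubmx_pdmx.
have d := derivable_entries_mul (@dR y k Vy) (@dur y k Vy).
have d' := derivable_entries_mul d (@dR y k Vy).
rewrite -(pdmx_mul (@dR y k Vy) (@dur y k Vy)) -(pdmx_mul d (@dR y k Vy)).
rewrite -(pdmx_opp (@dI y k Vy)) -(pdmx_sub (derivable_entries_opp (@dI y k Vy)) d').
by apply: (eq_pdmx _ oV Vy) => z Vz; apply/tame_dl/taming_tame.
Qed.

End TamingMap.

(** * Source terms of the field equations in symplectic form *)

Section Sources.
Variables (R : realType) (ns nv : nat) (U : set 'rV[R]_4) (V : set 'rV[R]_ns).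
Variables (J : 'rV[R]_ns -> 'M[R]_(nv + nv)) (c : config R ns nv).
Hypotheses (oV : open V) (tJ : taming V J) (cc : Conf U V J c).
Variable x : 'rV[R]_4.
Hypothesis Ux : U x.
Local Notation g := (cg c).
Local Notation F := (Fform c).
Local Notation y := (cphi c x).
Local Notation M := (fmx F x).

Let Vy : V y. Proof. by case: cc => [_ [_ [VU _]]]; exact: VU. Qed.
Let tK : tame (J y). Proof. exact: (taming_tame tJ). Qed.
Let gs : (g x)^T = g x. Proof. by have [] := lorentzian_det cc.1 Ux. Qed.
Let gd : \det (g x) < 0. Proof. by have [] := lorentzian_det cc.1 Ux. Qed.

Let Masym L : (M L)^T = - M L.
Proof.
apply: fmx_asym => a b z; rewrite /Fform.
by case: cc => [_ [_ [_ [[_ aF] _]]]]; rewrite aF linearN.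
Qed.

Let hodgeV a b : hodge g (cV c) a b x = - (J y *m cV c a b x).
Proof. by case: cc => [_ [_ [_ [_ hV]]]]; exact: hV. Qed.

Let starM a b L : usubmx (hodge g (cV c) a b x) L 0 = star (g x) (M L) a b.
Proof.
have -> : M L = fmx (cV c) x (lshift nv L) by apply/matrixP => p q; rewrite !mxE.
by rewrite -hodge_fmx !mxE.
Qed.

Let FM a b L : usubmx (cV c a b x) L 0 = M L a b.
Proof. by rewrite [RHS]mxE. Qed.

Lemma mul3_tr (h A B : 'M[R]_4) a b :
  \sum_(p < 4) \sum_(q < 4) A a p * h p q * B b q = (A *m h *m B^T) a b.
Proof.
rewrite exchange_big mxE /=; apply: eq_bigr => q _.
by rewrite !mxE mulr_suml.
Qed.

Lemma einstein_source a b :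
  2 * (\sum_(L < nv) \sum_(S < nv) Imat J y L S *
        \sum_(p < 4) \sum_(q < 4) F a p x L 0 * ginv g x p q * F b q x S 0)
  - 2^-1 * g x a b * (\sum_(L < nv) \sum_(S < nv) Imat J y L S *
        \sum_(p < 4) \sum_(q < 4) \sum_(r < 4) \sum_(s < 4)
           F p q x L 0 * ginv g x p r * ginv g x q s * F r s x S 0) =
  \sum_(p < 4) \sum_(q < 4) ginv g x p q * omega (cV c a p x) (J y *m cV c b q x).
Proof.
pose T L S := (M L *m ginv g x *m (M S)^T) a b.
have E1 L S : \sum_(p < 4) \sum_(q < 4) F a p x L 0 * ginv g x p q * F b q x S 0 = T L S.
  by rewrite /T -mul3_tr; apply: eq_bigr => p _; apply: eq_bigr => q _; rewrite ![M _ _ _]mxE.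
have E2 L S : \sum_(p < 4) \sum_(q < 4) \sum_(r < 4) \sum_(s < 4)
           F p q x L 0 * ginv g x p r * ginv g x q s * F r s x S 0 =
    pairing (g x) (M L) (M S).
  apply: eq_bigr => p _; apply: eq_bigr => q _; apply: eq_bigr => r _.
  by apply: eq_bigr => s _; rewrite ![M _ _ _]mxE.
under eq_bigr do under eq_bigr do rewrite E1.
under [X in _ - _ * X]eq_bigr do under eq_bigr do rewrite E2.
(* By [tame_omega] the right side is [I] contracted with [*F *F + F F]. *)
transitivity (\sum_L \sum_S Imat J y L S *
    ((star (g x) (M L) *m ginv g x *m (star (g x) (M S))^T) a b + T L S)); last first.
  rewrite /T; under eq_bigr do under eq_bigr do rewrite -!mul3_tr -big_split /= mulr_sumr.
  transitivity (\sum_L \sum_p \sum_S Imat J y L S *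
      (\sum_q star (g x) (M L) a p * ginv g x p q * star (g x) (M S) b q
       + \sum_q M L a p * ginv g x p q * M S b q)).
    by apply: eq_bigr => L _; rewrite exchange_big.
  rewrite exchange_big /=; apply: eq_bigr => p _.
  transitivity (\sum_L \sum_q \sum_S ginv g x p q * (Imat J y L S *
      (star (g x) (M L) a p * star (g x) (M S) b q + M L a p * M S b q))).
    apply: eq_bigr => L _; rewrite exchange_big /=; apply: eq_bigr => S _.
    rewrite -big_split /= mulr_sumr; apply: eq_bigr => q _; ring.
  rewrite exchange_big /=; apply: eq_bigr => q _.
  rewrite (tame_omega tK (hodgeV a p) (hodgeV b q)) mulr_sumr; apply: eq_bigr => L _.
  by rewrite mulr_sumr; apply: eq_bigr => S _; rewrite !starM !FM.
have Is L S : Imat J y L S = Imat J y S L.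
  by have /matrixP/(_ S L) := tame_Im_sym tK; rewrite mxE.
(* [star_mul] turns the [*F *F] term into [F F] with the labels [L] and [S] exchanged, plus the
   trace term. Symmetry of [I] undoes the exchange, whence the factor 2 in the stress tensor. *)
have ES L S : (star (g x) (M L) *m ginv g x *m (star (g x) (M S))^T) a b =
    T S L - 2^-1 * g x a b * pairing (g x) (M S) (M L).
  rewrite (star_asym (g x) (Masym S)) mulmxN (star_mul gs gd (Masym L) (Masym S)).
  rewrite (pairingE gs _ (Masym L)) /T (Masym L) mulmxN.
  move: (_ *m M L) (\tr _) => A t; rewrite !mxE; ring.
transitivity (\sum_L \sum_S Imat J y L S * T S L - 2^-1 * g x a b *
    (\sum_L \sum_S Imat J y L S * pairing (g x) (M S) (M L)) +
    \sum_L \sum_S Imat J y L S * T L S); last first.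
  rewrite mulr_sumr -sumrB -big_split; apply: eq_bigr => L _.
  rewrite mulr_sumr -sumrB -big_split; apply: eq_bigr => S _ /=; rewrite ES; ring.
have swap (B : 'I_nv -> 'I_nv -> R) :
    \sum_L \sum_S Imat J y L S * B S L = \sum_L \sum_S Imat J y L S * B L S.
  by rewrite exchange_big; apply: eq_bigr => L _; apply: eq_bigr => S _; rewrite Is.
by rewrite (swap T) (swap (fun L S => pairing (g x) (M L) (M S))); ring.
Qed.

Lemma scalar_source (k : 'I_ns) :
  2^-1 * (\sum_(L < nv) \sum_(S < nv) pd (fun y => Rmat J y L S) k y *
        \sum_(p < 4) \sum_(q < 4) \sum_(r < 4) \sum_(s < 4)
           F p q x L 0 * ginv g x p r * ginv g x q s * hodge g F r s x S 0)
  + 2^-1 * (\sum_(L < nv) \sum_(S < nv) pd (fun y => Imat J y L S) k y *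
        \sum_(p < 4) \sum_(q < 4) \sum_(r < 4) \sum_(s < 4)
           F p q x L 0 * ginv g x p r * ginv g x q s * F r s x S 0) =
  4^-1 * \sum_(p < 4) \sum_(q < 4) \sum_(r < 4) \sum_(s < 4)
    ginv g x p r * ginv g x q s * omega (cV c p q x) (pdmx J k y *m cV c r s x).
Proof.
have E1 L S : \sum_(p < 4) \sum_(q < 4) \sum_(r < 4) \sum_(s < 4)
           F p q x L 0 * ginv g x p r * ginv g x q s * F r s x S 0 =
    pairing (g x) (M L) (M S).
  apply: eq_bigr => p _; apply: eq_bigr => q _; apply: eq_bigr => r _.
  by apply: eq_bigr => s _; rewrite ![M _ _ _]mxE.
have E2 L S : \sum_(p < 4) \sum_(q < 4) \sum_(r < 4) \sum_(s < 4)
           F p q x L 0 * ginv g x p r * ginv g x q s * hodge g F r s x S 0 =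
    pairing (g x) (M L) (star (g x) (M S)).
  apply: eq_bigr => p _; apply: eq_bigr => q _; apply: eq_bigr => r _.
  by apply: eq_bigr => s _; rewrite -hodge_fmx ![fmx _ _ _ _ _]mxE.
under [X in _ * X + _]eq_bigr do under eq_bigr do rewrite E2.
under [X in _ + _ * X]eq_bigr do under eq_bigr do rewrite E1.
pose DR := pdmx (Rmat J) k y; pose DI := pdmx (Imat J) k y.
(* Since [*F.F = F.*F] and [*F.*F = - F.F], each contraction is half of the symmetric combination
   produced by [tame_omega_deriv]; this turns [1/2] into [1/4]. *)
transitivity (4^-1 * (\sum_L \sum_S (DR L S *
   (pairing (g x) (star (g x) (M L)) (M S) + pairing (g x) (M L) (star (g x) (M S))) +
   DI L S * (pairing (g x) (M L) (M S)
     - pairing (g x) (star (g x) (M L)) (star (g x) (M S)))))).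
  rewrite !mulr_sumr -big_split; apply: eq_bigr => L _ /=.
  rewrite !mulr_sumr -big_split; apply: eq_bigr => S _ /=.
  rewrite (pairing_star_star gs gd (Masym L) (Masym S)).
  rewrite (pairing_starC gs gd (Masym L) (Masym S)) ![_ L S]mxE.
  by move: (pd _ _ _) (pd _ _ _) (pairing _ _ _) (pairing _ _ _) => *; field.
congr (_ * _).
transitivity (\sum_L \sum_S \sum_(p < 4) \sum_(q < 4) \sum_(r < 4) \sum_(s < 4)
   ginv g x p r * ginv g x q s *
   (DR L S * (star (g x) (M L) p q * M S r s + M L p q * star (g x) (M S) r s) +
    DI L S * (M L p q * M S r s - star (g x) (M L) p q * star (g x) (M S) r s))).
  apply: eq_bigr => L _; apply: eq_bigr => S _.
  rewrite /pairing -big_split -sumrB !mulr_sumr -big_split; apply: eq_bigr => p _ /=.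
  rewrite -big_split -sumrB !mulr_sumr -big_split; apply: eq_bigr => q _ /=.
  rewrite -big_split -sumrB !mulr_sumr -big_split; apply: eq_bigr => r _ /=.
  rewrite -big_split -sumrB !mulr_sumr -big_split; apply: eq_bigr => s _ /=.
  by rewrite -/(ginv g x); ring.
transitivity (\sum_(p < 4) \sum_(q < 4) \sum_(r < 4) \sum_(s < 4) \sum_L \sum_S
   ginv g x p r * ginv g x q s *
   (DR L S * (star (g x) (M L) p q * M S r s + M L p q * star (g x) (M S) r s) +
    DI L S * (M L p q * M S r s - star (g x) (M L) p q * star (g x) (M S) r s))).
  under eq_bigr => L _ do rewrite -exchange_sum4.
  by rewrite -exchange_sum4.
apply: eq_bigr => p _; apply: eq_bigr => q _; apply: eq_bigr => r _; apply: eq_bigr => s _.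
rewrite (tame_omega_deriv tK (hodgeV p q) (hodgeV r s) (pdmx_Imat oV tJ k Vy)
  (pdmx_ul oV tJ k Vy) (pdmx_dr oV tJ k Vy) (pdmx_dl oV tJ k Vy)).
rewrite -big_split mulr_sumr; apply: eq_bigr => L _ /=.
rewrite -big_split mulr_sumr; apply: eq_bigr => S _ /=.
by rewrite !starM !FM.
Qed.

End Sources.

(** * Action on configurations and solutions *)

Section Configurations.
Variables (R : realType) (ns nv : nat) (U : set 'rV[R]_4) (V : set 'rV[R]_ns).
Hypotheses (oU : open U) (oV : open V).
Implicit Types (A : 'M[R]_(nv + nv)) (J : 'rV[R]_ns -> 'M[R]_(nv + nv)).

Lemma hodge_mul k l g (B : 'M[R]_(k, l)) (F : form2 R l) a b x :
  hodge g (fun a b x => B *m F a b x) a b x = B *m hodge g F a b x.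
Proof.
rewrite /hodge -scalemxAr; congr (_ *: _).
rewrite mulmx_sumr; apply: eq_bigr => c _; rewrite mulmx_sumr; apply: eq_bigr => d _.
rewrite mulmx_sumr; apply: eq_bigr => e _; rewrite mulmx_sumr; apply: eq_bigr => f _.
by rewrite scalemxAr.
Qed.

(** Only an intertwining relation between [J] and [J'] is asked, so the same lemma serves [f] with
    [A] and the inverse pair. *)
Lemma Conf_Amap J J' (f : 'rV[R]_ns -> 'rV[R]_ns) A (c : config R ns nv) :
  smooth_mx V f -> (forall y, V y -> V (f y)) ->
  (forall y, V y -> J' (f y) *m A = A *m J y) ->
  Conf U V J c -> Conf U V J' (Amap f A c).
Proof.
move=> sf fV JJ [lg [sphi [phiV [[sV aV] hV]]]]; split; first exact: lg.
split.
  exact: (smooth_mx_comp oU oV).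
split; first by move=> x Ux; apply/fV/phiV.
split; first split.
- by move=> a b; apply: smooth_mx_mull.
- by move=> a b x /=; rewrite aV mulmxN.
- move=> x Ux a b /=; rewrite hodge_mul hV //.
  by rewrite mulmxN !mulmxA JJ //; exact: phiV.
Qed.

Lemma symplectic_inv A : symplectic A -> symplectic (invmx A).
Proof.
move=> [uA sA]; split; first by rewrite unitmx_inv.
by move=> v w; rewrite -sA !mulKVmx.
Qed.

Lemma smooth_mx_mulr m p q r (W : set 'rV[R]_m) (h : 'rV[R]_m -> 'M[R]_(p, q))
    (B : 'M[R]_(q, r)) :
  open W -> smooth_mx W h -> smooth_mx W (fun x => h x *m B).
Proof.
move=> oW sh i j; apply/smooth_onP => k.
apply: (@eq_Ck _ k _ _ (fun x => \sum_l h x i l * B l j)) => //.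
  by move=> x _; rewrite mxE.
apply: Ck_sum => // l; apply: Ck_mul => //; last exact: Ck_cst.
by move/smooth_onP: (sh i l); apply.
Qed.

Lemma taming_Jtrans J (finv : 'rV[R]_ns -> 'rV[R]_ns) A :
  smooth_mx V finv -> (forall y, V y -> V (finv y)) -> symplectic A ->
  taming V J -> taming V (Jtrans finv A J).
Proof.
move=> sf fV sA [sJ tJ]; have [uA oA] := sA; have [uA' oA'] := symplectic_inv sA.
split.
  apply: smooth_mx_mulr oV _; apply: smooth_mx_mull oV _.
  exact: (smooth_mx_comp oV oV).
move=> y Vy; have [J2 [Js Jp]] := tJ _ (fV _ Vy); rewrite /Jtrans; split; [|split].
- rewrite -!mulmxA mulKmx // [J _ *m (J _ *m _)]mulmxA J2 mulNmx mul1mx mulmxN.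
  by rewrite mulmxV.
- by move=> v w; rewrite -!mulmxA oA Js oA'.
- move=> v v0; rewrite -{1}[v](mulKVmx uA) -!mulmxA oA; apply: Jp.
  by apply: contra v0 => /eqP E; rewrite -[v](mulKVmx uA) E mulmx0.
Qed.

End Configurations.

Lemma omega_sumr (R : realType) nv n (v : 'cV[R]_(nv + nv)) (e : 'I_n -> R)
    (w : 'I_n -> 'cV[R]_(nv + nv)) :
  omega v (\sum_m e m *: w m) = \sum_m e m * omega v (w m).
Proof.
rewrite /omega; under [RHS]eq_bigr do rewrite mulr_sumr.
rewrite exchange_big; apply: eq_bigr => a _ /=.
rewrite !summxE !mulr_sumr -sumrB; apply: eq_bigr => m _.
by rewrite !mxE; ring.
Qed.

(** * The field equations in matrix form *)

Section FieldEquations.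
Variables (R : realType) (ns nv : nat).

Definition dcol (e : config R ns nv) (a : 'I_4) (x : 'rV[R]_4) : 'cV[R]_ns :=
  \col_i dphi e i a x.

Lemma quadratic_dcol (B : 'M[R]_ns) e a b x :
  \sum_(i < ns) \sum_(j < ns) B i j * dphi e i a x * dphi e j b x =
  ((dcol e a x)^T *m B *m dcol e b x) 0 0.
Proof.
rewrite tr_mulmx11; apply: eq_bigr => i _; apply: eq_bigr => j _.
by rewrite !mxE mulrA.
Qed.

Lemma traced_quadratic_dcol (B : 'M[R]_ns) (h : 'M[R]_4) e x :
  \sum_(i < ns) \sum_(j < ns) B i j *
    \sum_(p < 4) \sum_(q < 4) h p q * dphi e i p x * dphi e j q x =
  \sum_(p < 4) \sum_(q < 4) h p q * ((dcol e p x)^T *m B *m dcol e q x) 0 0.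
Proof.
under eq_bigr do under eq_bigr do rewrite mulr_sumr.
under eq_bigr do rewrite exchange_big /=.
rewrite exchange_big /=; apply: eq_bigr => p _.
under eq_bigr do under eq_bigr do rewrite mulr_sumr.
under eq_bigr do rewrite exchange_big /=.
rewrite exchange_big /=; apply: eq_bigr => q _.
rewrite -quadratic_dcol mulr_sumr; apply: eq_bigr => i _.
by rewrite mulr_sumr; apply: eq_bigr => j _; ring.
Qed.

Definition einstein_rhs (G : 'rV[R]_ns -> 'M[R]_ns) (J : 'rV[R]_ns -> 'M[R]_(nv + nv))
    (c : config R ns nv) (a b : 'I_4) (x : 'rV[R]_4) : R :=
  ((dcol c a x)^T *m G (cphi c x) *m dcol c b x) 0 0
  - 2^-1 * cg c x a b * (\sum_(p < 4) \sum_(q < 4) ginv (cg c) x p q *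
      ((dcol c p x)^T *m G (cphi c x) *m dcol c q x) 0 0)
  + \sum_(p < 4) \sum_(q < 4) ginv (cg c) x p q *
      omega (cV c a p x) (J (cphi c x) *m cV c b q x).

Lemma einstein_eqsP (U : set 'rV[R]_4) (V : set 'rV[R]_ns) G J c :
  taming V J -> Conf U V J c ->
  einstein_eqs U G J c <->
  forall x, U x -> forall a b, einstein (cg c) a b x = einstein_rhs G J c a b x.
Proof.
move=> tJ cc; rewrite /einstein_eqs /=.
split=> H x Ux a b; have := H x Ux a b; rewrite /einstein_rhs.
  by rewrite -addrA (einstein_source tJ cc Ux) quadratic_dcol traced_quadratic_dcol.
by rewrite -[in X in _ -> X]addrA (einstein_source tJ cc Ux) quadratic_dcol traced_quadratic_dcol.
Qed.

Definition current (G : 'rV[R]_ns -> 'M[R]_ns) (c : config R ns nv) (k : 'I_ns) (a : 'I_4)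
    (x : 'rV[R]_4) : R :=
  \sum_(i < ns) G (cphi c x) i k * \sum_(b < 4) ginv (cg c) x a b * dphi c i b x.

Lemma currentE G c k a x : current G c k a x =
  \sum_(b < 4) ginv (cg c) x a b * ((G (cphi c x))^T *m dcol c b x) k 0.
Proof.
rewrite /current; under eq_bigr do rewrite mulr_sumr.
rewrite exchange_big; apply: eq_bigr => b _ /=; rewrite mxE mulr_sumr.
by apply: eq_bigr => i _; rewrite !mxE; ring.
Qed.

(** Both sides of the scalar equation brought together. Only this difference transforms as a
    covector in [k]; its divergence and kinetic parts separately acquire second derivatives of the
    coordinate change. *)
Definition scalar_lhs (G : 'rV[R]_ns -> 'M[R]_ns) (J : 'rV[R]_ns -> 'M[R]_(nv + nv))
    (c : config R ns nv) (k : 'I_ns) (x : 'rV[R]_4) : R :=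
  \sum_(a < 4) (pd (current G c k a) a x +
     \sum_(b < 4) christoffel (cg c) a a b x * current G c k b x)
  - 2^-1 * (\sum_(p < 4) \sum_(q < 4) ginv (cg c) x p q *
      ((dcol c p x)^T *m pdmx G k (cphi c x) *m dcol c q x) 0 0)
  - 4^-1 * \sum_(p < 4) \sum_(q < 4) \sum_(r < 4) \sum_(s < 4)
      ginv (cg c) x p r * ginv (cg c) x q s *
      omega (cV c p q x) (pdmx J k (cphi c x) *m cV c r s x).

Lemma scalar_eqsP (U : set 'rV[R]_4) (V : set 'rV[R]_ns) G J c :
  open V -> taming V J -> Conf U V J c ->
  scalar_eqs U G J c <-> forall x, U x -> forall k, scalar_lhs G J c k x = 0.
Proof.
move=> oV tJ cc; rewrite /scalar_eqs /=.
have E x k : \sum_(i < ns) \sum_(j < ns) pd (fun y => G y i j) k (cphi c x) *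
          \sum_(p < 4) \sum_(q < 4) ginv (cg c) x p q * dphi c i p x * dphi c j q x =
    \sum_(p < 4) \sum_(q < 4) ginv (cg c) x p q *
      ((dcol c p x)^T *m pdmx G k (cphi c x) *m dcol c q x) 0 0.
  rewrite -traced_quadratic_dcol; apply: eq_bigr => i _; apply: eq_bigr => j _.
  by rewrite mxE.
split=> H x Ux k.
  rewrite /scalar_lhs -(scalar_source oV tJ cc Ux) -E; apply/eqP.
  by rewrite -addrA -opprD subr_eq0 addrA; apply/eqP; exact: H.
have := H x Ux k; rewrite /scalar_lhs -(scalar_source oV tJ cc Ux) -E => /eqP.
by rewrite -addrA -opprD subr_eq0 addrA => /eqP.
Qed.

End FieldEquations.

Lemma derive_coord (R : realType) n (i j : 'I_n) (y : 'rV[R]_n) :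
  'D_(ei R j) (fun z : 'rV[R]_n => z 0 i) y = (i == j)%:R.
Proof.
have := @derive_mx R _ 1 n id y (ei R j) (@derivable_id _ _ y (ei R j)).
rewrite derive_id => /matrixP/(_ 0 i); rewrite [RHS]mxE => <-.
by rewrite mxE eqxx.
Qed.

Lemma sum_scalar_comb (R : realType) n (e b1 b2 b3 : 'I_n -> R) :
  \sum_l e l * (b1 l - 2^-1 * b2 l - 4^-1 * b3 l) =
  \sum_l e l * b1 l - 2^-1 * (\sum_l e l * b2 l) - 4^-1 * (\sum_l e l * b3 l).
Proof.
by rewrite !mulr_sumr -!sumrB; apply: eq_bigr => l _; ring.
Qed.

(** * Comparison of the field equations of a configuration and its image *)

Section Transformation.
Variables (R : realType) (ns nv : nat) (U : set 'rV[R]_4) (V : set 'rV[R]_ns).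
Variables (G : 'rV[R]_ns -> 'M[R]_ns) (J : 'rV[R]_ns -> 'M[R]_(nv + nv)).
Variables (f finv : 'rV[R]_ns -> 'rV[R]_ns) (A : 'M[R]_(nv + nv)).
Hypotheses (oU : open U) (oV : open V) (rG : riemannian V G) (tJ : taming V J).
Hypotheses (df : diffeo V f finv) (sA : symplectic A).
(* [c'] need only agree with [Amap f A c] on [U]; this lets the equivalences
   below also be read from [c'] back to [c := Amap finv (invmx A) c']. *)
Variables (c c' : config R ns nv).
Hypotheses (cg' : cg c' = cg c).
Hypotheses (cphi' : forall x, U x -> cphi c' x = f (cphi c x)).
Hypotheses (cV' : forall a b x, cV c' a b x = A *m cV c a b x).
Local Notation G' := (pushforward finv G).
Local Notation J' := (Jtrans finv A J).
Hypotheses (cc : Conf U V J c) (cc' : Conf U V J' c').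

Let sf : smooth_mx V f. Proof. by case: df. Qed.
Let sfinv : smooth_mx V finv. Proof. by case: df => _ []. Qed.
Let fV y : V y -> V (f y). Proof. by case: df => _ [_ []]; auto. Qed.
Let finvV y : V y -> V (finv y). Proof. by case: df => _ [_ [_ []]]; auto. Qed.
Let finvK y : V y -> finv (f y) = y. Proof. by case: df => _ [_ [_ [_ [_ []]]]]; auto. Qed.
Let phiV x : U x -> V (cphi c x). Proof. by case: cc => [_ [_ [VU _]]]; exact: VU. Qed.
Let phiV' x : U x -> V (cphi c' x). Proof. by case: cc' => [_ [_ [VU _]]]; exact: VU. Qed.
Let tJ' : taming V J'. Proof. exact: taming_Jtrans. Qed.
Let uA : A \in unitmx. Proof. by case: sA. Qed.
Let finvphi x : U x -> finv (cphi c' x) = cphi c x.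
Proof. by move=> Ux; rewrite cphi' // finvK //; exact: phiV. Qed.

Let dcphi x a i : U x -> derivable (fun z => cphi c z 0 i) x (ei R a).
Proof. by case: cc => [_ [sphi _]] Ux; exact: smooth_on_derivable (sphi 0 i) Ux. Qed.
Let dcphi' x a i : U x -> derivable (fun z => cphi c' z 0 i) x (ei R a).
Proof. by case: cc' => [_ [sphi _]] Ux; exact: smooth_on_derivable (sphi 0 i) Ux. Qed.

Lemma jac_mul y : V y -> jac finv (f y) *m jac f y = 1%:M.
Proof.
move=> Vy; apply/matrixP => i j; rewrite !mxE -(derive_coord i j y).
have D : is_derive y (ei R j) ((fun w => finv w 0 i) \o f)
    (\sum_l pd (fun w => finv w 0 i) l (f y) * 'D_(ei R j) (fun z => f z 0 l) y).
  apply: (@Ck1_is_derive_comp _ _ _ V) => //.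
  - exact/smooth_on_Ck/sfinv.
  - exact: fV.
  - by move=> l; exact: smooth_on_derivable (sf 0 l) Vy.
have <- : pd ((fun w => finv w 0 i) \o f) j y = 'D_(ei R j) (fun z : 'rV[R]_ns => z 0 i) y.
  by apply: (eq_pd _ oV Vy) => z Vz /=; rewrite finvK.
rewrite /pd (@derive_val _ _ _ _ _ _ _ D).
by apply: eq_bigr => l _; rewrite !mxE.
Qed.

Lemma dcol_trans a x : U x -> dcol c' a x = jac f (cphi c x) *m dcol c a x.
Proof.
move=> Ux; apply/colP => i; rewrite !mxE /dphi.
rewrite (@eq_pd _ _ U _ _ ((fun w => f w 0 i) \o cphi c) a x) //; last first.
  by move=> z Uz /=; rewrite cphi'.
have D : is_derive x (ei R a) ((fun w => f w 0 i) \o cphi c)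
    (\sum_l pd (fun w => f w 0 i) l (cphi c x) * 'D_(ei R a) (fun z => cphi c z 0 l) x).
  apply: (@Ck1_is_derive_comp _ _ _ V) => //.
  - exact/smooth_on_Ck/sf.
  - exact: phiV.
  - by move=> l; exact: dcphi.
rewrite /pd (@derive_val _ _ _ _ _ _ _ D).
by apply: eq_bigr => l _; rewrite !mxE.
Qed.

Local Notation K x := (jac finv (cphi c' x)).

Lemma K_mul x : U x -> K x *m jac f (cphi c x) = 1%:M.
Proof. by move=> Ux; rewrite cphi' //; apply/jac_mul/phiV. Qed.

Lemma K_dcol a x : U x -> K x *m dcol c' a x = dcol c a x.
Proof. by move=> Ux; rewrite dcol_trans // mulmxA K_mul // mul1mx. Qed.

Lemma pushforwardE x : U x -> G' (cphi c' x) = (K x)^T *m G (cphi c x) *m K x.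
Proof. by move=> Ux; rewrite /pushforward finvphi. Qed.

Lemma kinetic_trans a b x : U x ->
  (dcol c' a x)^T *m G' (cphi c' x) *m dcol c' b x =
  (dcol c a x)^T *m G (cphi c x) *m dcol c b x.
Proof.
move=> Ux; rewrite pushforwardE // !mulmxA -trmx_mul K_dcol //.
by rewrite -mulmxA K_dcol.
Qed.

(** [B] is arbitrary so that this covers the value of [J] in the Einstein equations as well as its
    derivatives in the scalar equations. *)
Lemma omega_trans x (a b p q : 'I_4) (B : 'M[R]_(nv + nv)) :
  omega (cV c' a b x) (A *m B *m invmx A *m cV c' p q x) =
  omega (cV c a b x) (B *m cV c p q x).
Proof. by case: sA => _ oA; rewrite !cV' -!mulmxA mulKmx // oA. Qed.

Lemma Jtrans_phi x : U x -> J' (cphi c' x) = A *m J (cphi c x) *m invmx A.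
Proof. by move=> Ux; rewrite /Jtrans finvphi. Qed.

Lemma einstein_eqs_trans : einstein_eqs U G J c <-> einstein_eqs U G' J' c'.
Proof.
have kin p q x : U x ->
    ((dcol c p x)^T *m G (cphi c x) *m dcol c q x) 0 0 =
    ((dcol c' p x)^T *m G' (cphi c' x) *m dcol c' q x) 0 0.
  by move=> Ux; exact: (congr1 (fun X : 'M[R]_1 => X 0 0) (esym (kinetic_trans p q Ux))).
have E x a b : U x -> einstein_rhs G J c a b x = einstein_rhs G' J' c' a b x.
  move=> Ux; rewrite /einstein_rhs cg'.
  apply: (f_equal3 (fun u v w => u - 2^-1 * cg c x a b * v + w)); first exact: kin.
    apply: eq_bigr => p _; apply: eq_bigr => q _.
    exact: (congr1 (fun z => ginv (cg c) x p q * z) (kin p q x Ux)).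
  apply: eq_bigr => p _; apply: eq_bigr => q _.
  by rewrite (Jtrans_phi Ux) omega_trans.
split=> [/(einstein_eqsP G tJ cc) H|/(einstein_eqsP G' tJ' cc') H].
  by apply/(einstein_eqsP G' tJ' cc') => x Ux a b; rewrite cg' H // E.
by apply/(einstein_eqsP G tJ cc) => x Ux a b; rewrite -cg' H // E.
Qed.

Lemma maxwell_eqs_trans : maxwell_eqs U c <-> maxwell_eqs U c'.
Proof.
have E a b e x : U x -> pd (cV c' a b) e x = A *m pd (cV c a b) e x.
  move=> Ux; have dV : derivable (cV c a b) x (ei R e).
    apply/derivable_mxP => i j; case: cc => [_ [_ [_ [[sV _] _]]]].
    exact: smooth_on_derivable (sV a b i j) Ux.
  have dV' : derivable (cV c' a b) x (ei R e).
    apply/derivable_mxP => i j; case: cc' => [_ [_ [_ [[sV _] _]]]].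
    exact: smooth_on_derivable (sV a b i j) Ux.
  rewrite /pd (derive_mx dV) (derive_mx dV'); apply/matrixP => i j; rewrite !mxE.
  rewrite (_ : (fun t => _) = fun t => \sum_l A i l * cV c a b t l j); last first.
    by apply/funext => t; rewrite cV' mxE.
  apply: derive_val; apply: is_derive_bigsum => l; rewrite mxE.
  have dl := (derivable_mxP _ _ _).1 dV l j.
  have := is_derive_mul (is_derive_cst (A i l) x (ei R e)) (derivableP dl).
  by rewrite mul0r add0r.
split=> H x Ux a b e; have := H x Ux a b e.
  by rewrite !E // -!mulmxDr => ->; rewrite mulmx0.
by rewrite !E // -!mulmxDr => /(congr1 (mulmx (invmx A))); rewrite mulKmx // mulmx0.
Qed.

Lemma current_trans k a x : U x ->
  current G' c' k a x = \sum_l K x l k * current G c l a x.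
Proof.
move=> Ux; rewrite currentE.
have E b : (G' (cphi c' x))^T *m dcol c' b x =
    (K x)^T *m ((G (cphi c x))^T *m dcol c b x).
  by rewrite pushforwardE // !trmx_mul trmxK -!mulmxA K_dcol.
under eq_bigr do rewrite E mxE mulr_sumr.
rewrite exchange_big; apply: eq_bigr => l _ /=; rewrite currentE mulr_sumr.
by apply: eq_bigr => b _; rewrite [(K x)^T _ _]mxE cg' mulrCA.
Qed.

Lemma derivable_current l a b x : U x -> derivable (current G c l a) x (ei R b).
Proof.
move=> Ux; apply: derivable_bigsum => i; apply: derivable_mul.
  apply: (@ex_derive _ _ _ _ _ _ _ (@Ck1_is_derive_comp _ _ _ V (fun y => G y i l) _ _ _ oV _ _ _)).
  - by apply: smooth_on_Ck; case: rG => sG _; exact: sG.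
  - exact: phiV.
  - by move=> j; exact: dcphi.
apply: derivable_bigsum => e; apply: derivable_mul.
  have [sg _] := cc.1.
  apply: derivable_invmx => [|i' j']; last exact: smooth_on_derivable (sg i' j') Ux.
  apply: (near_open oU Ux) => z Uz; rewrite unitmxE unitfE.
  by have [_ d0] := lorentzian_det cc.1 Uz; rewrite lt_eqF.
case: cc => [_ [sphi _]].
exact: smooth_on_derivable (smooth_on_pd e (sphi 0 i)) Ux.
Qed.

Let derivable_jac y k : V y -> derivable_entries (jac finv) y k.
Proof.
move=> Vy i j; rewrite (_ : (fun z => _) = pd (fun w => finv w 0 i) j).
  exact: smooth_on_derivable (smooth_on_pd j (sfinv 0 i)) Vy.
by apply/funext => z; rewrite mxE.
Qed.

Lemma pdmx_jac_sym y k i j : V y ->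
  pdmx (jac finv) k y i j = pdmx (jac finv) j y i k.
Proof.
have E a b : (fun z => jac finv z a b) = pd (fun w => finv w 0 a) b.
  by apply/funext => z; rewrite mxE.
by move=> Vy; rewrite [LHS]mxE [RHS]mxE (E i j) (E i k); exact: smooth_on_pdC oV (sfinv 0 i) Vy.
Qed.

(** The chain rule yields [d_m K_lk] contracted with [d_a phi'^m]. Symmetry of the second
    derivatives of [finv] turns it into [d_k K_lm], the shape in which the derivative of the
    pushed-forward metric produces the same quantity. *)
Lemma is_derive_K l k a x : U x ->
  is_derive x (ei R a) (fun z => K z l k)
    ((pdmx (jac finv) k (cphi c' x) *m dcol c' a x) l 0).
Proof.
move=> Ux; have Vx := phiV' Ux.
apply: (@is_derive_eq _ _ _ _ _ _ _ _
  (@Ck1_is_derive_comp _ _ _ V (fun w => jac finv w l k) (cphi c') _ _ oV _ Vx _)).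
- rewrite (_ : (fun w => _) = pd (fun w => finv w 0 l) k).
    exact/smooth_on_Ck/smooth_on_pd/sfinv.
  by apply/funext => z; rewrite mxE.
- by move=> m; exact: dcphi'.
- rewrite mxE; apply: eq_bigr => m _; rewrite pdmx_jac_sym //.
  by rewrite [pdmx _ _ _ _ _]mxE [dcol _ _ _ _ _]mxE.
Qed.

Lemma pd_current_trans k a x : U x -> pd (current G' c' k a) a x =
  \sum_l ((pdmx (jac finv) k (cphi c' x) *m dcol c' a x) l 0 * current G c l a x
          + K x l k * pd (current G c l a) a x).
Proof.
move=> Ux.
rewrite (eq_pd (h' := fun z => \sum_l K z l k * current G c l a z) _ oU Ux); last first.
  by move=> z Uz; exact: current_trans.
apply: derive_val; apply: is_derive_bigsum => l; apply: is_derive_mul.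
  exact: is_derive_K.
by apply: derivableP; exact: derivable_current.
Qed.

Let is_derive_comp_finv p q (M : 'rV[R]_ns -> 'M[R]_(p, q)) y k i j :
  smooth_mx V M -> V y ->
  is_derive y (ei R k) (fun z => M (finv z) i j)
    ((\sum_m jac finv y m k *: pdmx M m (finv y)) i j).
Proof.
move=> sM Vy.
apply: (@is_derive_eq _ _ _ _ _ _ _ _
  (@Ck1_is_derive_comp _ _ _ V (fun w => M w i j) finv y _ oV _ (finvV Vy) _)).
- exact/smooth_on_Ck/sM.
- by move=> m; exact: smooth_on_derivable (sfinv 0 m) Vy.
- by rewrite summxE; apply: eq_bigr => m _; rewrite !mxE mulrC.
Qed.

Let derivable_comp_finv p q (M : 'rV[R]_ns -> 'M[R]_(p, q)) y k :
  smooth_mx V M -> V y -> derivable_entries (fun z => M (finv z)) y k.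
Proof. by move=> sM Vy i j; case: (is_derive_comp_finv k i j sM Vy). Qed.

Lemma pdmx_comp_finv p q (M : 'rV[R]_ns -> 'M[R]_(p, q)) y k :
  smooth_mx V M -> V y ->
  pdmx (fun z => M (finv z)) k y = \sum_m jac finv y m k *: pdmx M m (finv y).
Proof.
move=> sM Vy; apply/matrixP => i j; rewrite [LHS]mxE.
exact: (@derive_val _ _ _ _ _ _ _ (is_derive_comp_finv k i j sM Vy)).
Qed.

Lemma pdmx_Jtrans x k : U x -> pdmx J' k (cphi c' x) =
  A *m (\sum_m K x m k *: pdmx J m (cphi c x)) *m invmx A.
Proof.
move=> Ux; have Vx := phiV' Ux; have [sJ _] := tJ.
have dA (B : 'M[R]_(nv + nv)) : derivable_entries (fun=> B) (cphi c' x) k.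
  by move=> i j; exact: derivable_cst.
have dJ := @derivable_comp_finv _ _ J (cphi c' x) k sJ Vx.
have dAJ := derivable_entries_mul (dA A) dJ.
rewrite (pdmx_mul dAJ (dA _)) pdmx_cst mulmx0 addr0 (pdmx_mul (dA A) dJ).
by rewrite pdmx_cst mul0mx add0r (pdmx_comp_finv _ sJ Vx) finvphi.
Qed.

Lemma pdmx_pushforward x k : U x -> pdmx G' k (cphi c' x) =
  (pdmx (jac finv) k (cphi c' x))^T *m G (cphi c x) *m K x
  + (K x)^T *m (\sum_m K x m k *: pdmx G m (cphi c x)) *m K x
  + (K x)^T *m G (cphi c x) *m pdmx (jac finv) k (cphi c' x).
Proof.
move=> Ux; have Vx := phiV' Ux; have [sG _] := rG.
have dK := @derivable_jac (cphi c' x) k Vx.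
have dKt : derivable_entries (fun z => (jac finv z)^T) (cphi c' x) k.
  move=> i j; rewrite (_ : (fun z => _) = fun z => jac finv z j i); first exact: dK.
  by apply/funext => z; rewrite mxE.
have dG := @derivable_comp_finv _ _ G (cphi c' x) k sG Vx.
have dKG := derivable_entries_mul dKt dG.
rewrite (pdmx_mul dKG dK) (pdmx_mul dKt dG) pdmx_tr (pdmx_comp_finv _ sG Vx).
by rewrite finvphi // mulmxDl.
Qed.

(** Differentiating [K^T G K] hits each Jacobian once; symmetry of [G] gives both resulting terms
    the same shape, with [p] and [q] exchanged. *)
Lemma kinetic_pushforward k p q x : U x ->
  ((dcol c' p x)^T *m pdmx G' k (cphi c' x) *m dcol c' q x) 0 0 =
  ((pdmx (jac finv) k (cphi c' x) *m dcol c' p x)^T *m G (cphi c x) *m dcol c q x) 0 0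
  + ((pdmx (jac finv) k (cphi c' x) *m dcol c' q x)^T *m G (cphi c x) *m dcol c p x) 0 0
  + \sum_m K x m k * ((dcol c p x)^T *m pdmx G m (cphi c x) *m dcol c q x) 0 0.
Proof.
move=> Ux; have Gs : (G (cphi c x))^T = G (cphi c x).
  by case: rG => _ /(_ _ (phiV Ux))[].
set P := pdmx (jac finv) k (cphi c' x).
have e1 : (dcol c' p x)^T *m (P^T *m G (cphi c x) *m K x) *m dcol c' q x =
    (P *m dcol c' p x)^T *m G (cphi c x) *m dcol c q x.
  by rewrite -!mulmxA (K_dcol q Ux) !mulmxA -trmx_mul.
have e2 (N : 'M[R]_ns) : (dcol c' p x)^T *m ((K x)^T *m N *m K x) *m dcol c' q x =
    (dcol c p x)^T *m N *m dcol c q x.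
  by rewrite -!mulmxA (K_dcol q Ux) !mulmxA -trmx_mul (K_dcol p Ux).
have e3 : (dcol c' p x)^T *m ((K x)^T *m G (cphi c x) *m P) *m dcol c' q x =
    ((P *m dcol c' q x)^T *m G (cphi c x) *m dcol c p x)^T.
  by rewrite !mulmxA -trmx_mul (K_dcol p Ux) !trmx_mul !trmxK Gs !mulmxA.
rewrite (pdmx_pushforward _ Ux) -/P !mulmxDr !mulmxDl e1 e2 e3.
have add3 (X Y Z : 'M[R]_1) : (X + Y + Z^T) 0 0 = X 0 0 + Z 0 0 + Y 0 0.
  by rewrite !mxE addrAC.
rewrite add3 mulmx_sumr mulmx_suml summxE; congr (_ + _).
by apply: eq_bigr => m _; rewrite -scalemxAr -scalemxAl mxE.
Qed.

Lemma scalar_lhs_trans k x : U x ->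
  scalar_lhs G' J' c' k x = \sum_l K x l k * scalar_lhs G J c l x.
Proof.
move=> Ux; pose W a := pdmx (jac finv) k (cphi c' x) *m dcol c' a x.
(* [S] carries all the second derivatives of [finv], which must disappear from the final
   identity. *)
pose S p q := ((W p)^T *m G (cphi c x) *m dcol c q x) 0 0.
pose T m p q := ((dcol c p x)^T *m pdmx G m (cphi c x) *m dcol c q x) 0 0.
pose h := ginv (cg c) x.
have Gs : (G (cphi c x))^T = G (cphi c x) by case: rG => _ /(_ _ (phiV Ux))[].
have hs p q : h p q = h q p.
  have [gs _] := lorentzian_det cc.1 Ux.
  by have /matrixP/(_ q p) := invmx_sym gs; rewrite mxE.
have kin : \sum_(p < 4) \sum_(q < 4) h p q *
      ((dcol c' p x)^T *m pdmx G' k (cphi c' x) *m dcol c' q x) 0 0 =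
    2 * (\sum_(p < 4) \sum_(q < 4) h p q * S p q) +
    \sum_m K x m k * (\sum_(p < 4) \sum_(q < 4) h p q * T m p q).
  have swap : \sum_(p < 4) \sum_(q < 4) h p q * S q p =
      \sum_(p < 4) \sum_(q < 4) h p q * S p q.
    rewrite exchange_big; apply: eq_bigr => p _; apply: eq_bigr => q _.
    exact: (congr1 (fun z => z * S p q) (hs q p)).
  have -> : \sum_m K x m k * (\sum_(p < 4) \sum_(q < 4) h p q * T m p q) =
      \sum_(p < 4) \sum_(q < 4) h p q * \sum_m K x m k * T m p q.
    under eq_bigr do rewrite mulr_sumr.
    rewrite exchange_big; apply: eq_bigr => p _ /=.
    under eq_bigr do rewrite mulr_sumr.
    rewrite exchange_big; apply: eq_bigr => q _ /=.
    by rewrite mulr_sumr; apply: eq_bigr => m _; rewrite mulrCA.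
  rewrite mulr2n mulrDl mul1r -[X in X + _ + _]swap -!big_split /=.
  apply: eq_bigr => p _; rewrite -!big_split /=; apply: eq_bigr => q _.
  have lin3 (u s1 s2 t : R) : u * (s1 + s2 + t) = u * s2 + u * s1 + u * t by ring.
  apply: (etrans (congr1 (fun z => h p q * z) (kinetic_pushforward k p q Ux))).
  exact: lin3.
have src : \sum_(p < 4) \sum_(q < 4) \sum_(r < 4) \sum_(s < 4) h p r * h q s *
      omega (cV c' p q x) (pdmx J' k (cphi c' x) *m cV c' r s x) =
    \sum_m K x m k * \sum_(p < 4) \sum_(q < 4) \sum_(r < 4) \sum_(s < 4) h p r * h q s *
      omega (cV c p q x) (pdmx J m (cphi c x) *m cV c r s x).
  under [RHS]eq_bigr do rewrite mulr_sumr; under [RHS]eq_bigr do under eq_bigr do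
    rewrite mulr_sumr; under [RHS]eq_bigr do under eq_bigr do under eq_bigr do
    rewrite mulr_sumr; under [RHS]eq_bigr do under eq_bigr do under eq_bigr do
    under eq_bigr do rewrite mulr_sumr.
  rewrite -exchange_sum4; apply: eq_bigr => p _; apply: eq_bigr => q _.
  apply: eq_bigr => r _; apply: eq_bigr => s _.
  rewrite (pdmx_Jtrans k Ux) omega_trans mulmx_suml.
  under eq_bigr do rewrite -scalemxAl.
  by rewrite omega_sumr mulr_sumr; apply: eq_bigr => m _; rewrite mulrCA.
(* The non-covariant part of the divergence is the same contraction of [S] as in [kin]. *)
have cur : \sum_(a < 4) \sum_l W a l 0 * current G c l a x =
    \sum_(p < 4) \sum_(q < 4) h p q * S p q.
  apply: eq_bigr => a _; under eq_bigr do rewrite currentE Gs mulr_sumr.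
  rewrite exchange_big; apply: eq_bigr => b _ /=.
  rewrite /S -mulmxA mxE mulr_sumr; apply: eq_bigr => l _.
  by rewrite [(W a)^T _ _]mxE mulrCA.
have div : \sum_(a < 4) (pd (current G' c' k a) a x +
     \sum_(b < 4) christoffel (cg c) a a b x * current G' c' k b x) =
    \sum_(p < 4) \sum_(q < 4) h p q * S p q + \sum_l K x l k *
    \sum_(a < 4) (pd (current G c l a) a x +
       \sum_(b < 4) christoffel (cg c) a a b x * current G c l b x).
  rewrite -cur; under [X in _ = _ + X]eq_bigr do rewrite mulr_sumr.
  rewrite [X in _ = _ + X]exchange_big -big_split; apply: eq_bigr => a _ /=.
  rewrite (pd_current_trans k a Ux) big_split /= -addrA; congr (_ + _).
  under [X in _ + X]eq_bigr do rewrite (current_trans k _ Ux) mulr_sumr.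
  rewrite exchange_big -big_split; apply: eq_bigr => l _ /=.
  rewrite mulrDr mulr_sumr; congr (_ + _); apply: eq_bigr => b _.
  by rewrite mulrCA.
rewrite /scalar_lhs cg' -/h div kin src.
(* The cancellation: [S] enters once through the divergence and with [-1/2] times [2] through the
   kinetic term. *)
have comb (q ka kb kc : R) :
  q + ka - 2^-1 * (2 * q + kb) - 4^-1 * kc = ka - 2^-1 * kb - 4^-1 * kc by field.
exact: (etrans (comb _ _ _ _) (esym (sum_scalar_comb (fun l => K x l k) _ _ _))).
Qed.

Lemma scalar_eqs_trans : scalar_eqs U G J c <-> scalar_eqs U G' J' c'.
Proof.
split=> [/(scalar_eqsP G oV tJ cc) H|/(scalar_eqsP G' oV tJ' cc') H].
  apply/(scalar_eqsP G' oV tJ' cc') => x Ux k; rewrite scalar_lhs_trans //.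
  by rewrite big1 // => l _; rewrite H // mulr0.
apply/(scalar_eqsP G oV tJ cc) => x Ux k.
(* All scalar equations at [x] form one column killed by [K^T]; transposing [K jac f = 1] gives a
   left inverse of [K^T]. *)
pose e : 'cV[R]_ns := \col_l scalar_lhs G J c l x.
have Ke : (K x)^T *m e = 0.
  apply/colP => l; rewrite [RHS]mxE -(H x Ux l) scalar_lhs_trans // mxE.
  by apply: eq_bigr => m _; rewrite !mxE.
suff : e = 0 by move=> /colP/(_ k); rewrite !mxE.
rewrite -[e]mul1mx -(trmx1 R) -(K_mul Ux) trmx_mul -mulmxA Ke mulmx0 //.
Qed.

End Transformation.

Theorem theorem2p17 (R : realType) (ns nv : nat)
  (U : set 'rV[R]_4) (V : set 'rV[R]_ns)
  (G : 'rV[R]_ns -> 'M[R]_ns) (J : 'rV[R]_ns -> 'M[R]_(nv + nv))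
  (f finv : 'rV[R]_ns -> 'rV[R]_ns) (A : 'M[R]_(nv + nv)) :
  spacetime_domain U -> open V ->
  riemannian V G -> taming V J ->
  diffeo V f finv -> symplectic A ->
  bij_onU U (Conf U V J) (Conf U V (Jtrans finv A J)) (Amap f A) /\
  bij_onU U (Sol U V G J) (Sol U V (pushforward finv G) (Jtrans finv A J)) (Amap f A).
Proof.
move=> [oU _] oV rG tJ df sA.
have [sf [sfi [fV [fiV [fK [fiK _]]]]]] := df; have [uA _] := sA.
have fwd c : Conf U V J c -> Conf U V (Jtrans finv A J) (Amap f A c).
  apply: (Conf_Amap oU oV sf fV) => y Vy.
  by rewrite /Jtrans fiK // mulmxKV.
have bwd c : Conf U V (Jtrans finv A J) c -> Conf U V J (Amap finv (invmx A) c).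
  apply: (Conf_Amap oU oV sfi fiV) => y Vy.
  by rewrite /Jtrans -!mulmxA mulKmx.
have sol c c' : cg c' = cg c -> (forall x, U x -> cphi c' x = f (cphi c x)) ->
    (forall a b x, cV c' a b x = A *m cV c a b x) ->
    Conf U V J c -> Conf U V (Jtrans finv A J) c' ->
    Sol U V G J c <-> Sol U V (pushforward finv G) (Jtrans finv A J) c'.
  move=> Eg Ephi EV cc cc'.
  have Ee := einstein_eqs_trans G oU oV tJ df sA Eg Ephi EV cc cc'.
  have Es := scalar_eqs_trans oU oV rG tJ df sA Eg Ephi EV cc cc'.
  have Em := maxwell_eqs_trans sA EV cc cc'.
  by split=> -[_ [He [Hs Hm]]]; (split; first by []); split;
    [exact/Ee|split; [exact/Es|exact/Em]|exact/Ee|split; [exact/Es|exact/Em]].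
have cong c c' : eqU U c c' -> eqU U (Amap f A c) (Amap f A c').
  by move=> E x /E[/= -> [-> EV]]; split=> //; split=> // a b; rewrite EV.
have inj c c' : Conf U V J c -> Conf U V J c' ->
    eqU U (Amap f A c) (Amap f A c') -> eqU U c c'.
  move=> [_ [_ [cV [_ _]]]] [_ [_ [cV' [_ _]]]] E x Ux.
  have [/= Eg [Ephi EV]] := E x Ux; split=> //; split=> [|a b].
    by rewrite -[LHS]fiK ?Ephi ?fiK //; [exact: cV'|exact: cV].
  by rewrite -[LHS](mulKmx uA) EV mulKmx.
(* [f (finv y) = y] is known only on [V], so the candidate preimage reproduces [c'] only on [U],
   which is what [eqU] asks. *)
have lift c' : Conf U V (Jtrans finv A J) c' ->
    eqU U (Amap f A (Amap finv (invmx A) c')) c'.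
  move=> [_ [_ [cV' _]]] x Ux; split=> //; split=> [|a b] /=.
    by rewrite fK //; exact: cV'.
  by rewrite mulKVmx.
split; split.
- exact: fwd.
- split; first by move=> c c' _ _; exact: cong.
  split; first exact: inj.
  by move=> c' cc'; exists (Amap finv (invmx A) c'); [exact: bwd|exact: lift].
- by move=> c Sc; apply: (sol c _ _ _ _ Sc.1 (fwd _ Sc.1)).1.
- split; first by move=> c c' _ _; exact: cong.
  split; first by move=> c c' [cc _] [cc' _]; exact: inj.
  move=> c' Sc'; exists (Amap finv (invmx A) c'); last by apply: lift; case: Sc'.
  (* [sol] is used with [c'] itself rather than with the image of its candidate preimage, so no
     transport of [Sol] along [eqU] is needed. *)
  have cc' := Sc'.1; apply: (sol _ c' _ _ _ (bwd _ cc') cc').2 => //.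
    by move=> x Ux /=; rewrite fK //; case: cc' => [_ [_ [VU _]]]; exact: VU.
  by move=> a b x /=; rewrite mulKVmx.
Qed.
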